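(* Let $t$ be an arbitrary non-negative integer and let $d_t:=5(2^t-1)+50\cdot 2^t$. Then the space of coinvariants $\mathbb Z/2\otimes_{GL_5}P_{\mathbb A}H_{d_t}(V^{\oplus 5})$ is trivial (i.e. equal to $0$).
   Context: $\mathbb A$ is the mod 2 Steenrod algebra, generated by the Steenrod squares $Sq^k$. $V^{\oplus n}$ is the $n$-dimensional vector space over $\mathbb Z/2$. $H^*(V^{\oplus n})$ and $H_*(V^{\oplus n})$ are the mod 2 cohomology and homology of the classifying space $BV^{\oplus n}$. $H^*(V^{\oplus n})=\mathbb Z/2[u_1,\ldots,u_n]$ with $\deg u_i=1$, with its usual unstable $\mathbb A$-algebra structure (determined by the Cartan formula, $Sq^0=\mathrm{id}$, $Sq^1u_i=u_i^2$ and $Sq^ku_i=0$ for $k>1$), and $H_*(V^{\oplus n})$ is its graded dual. $P_{\mathbb A}H_d(V^{\oplus n})$ is the subspace of $H_d(V^{\oplus n})$ of all elements annihilated by all (dual) Steenrod squares of positive degree; i.e. $x\in H_d(V^{\oplus n})$ lies in it iff $\langle Sq^kf,x\rangle=0$ for all $k>0$ and all $f\in H^{d-k}(V^{\oplus n})$. The group $GL_n=GL(V^{\oplus n})$ acts on $H^*(V^{\oplus n})$ by linear substitution of the variables and dually on $H_*(V^{\oplus n})$, commuting with $\mathbb A$, hence it acts on $P_{\mathbb A}H_d(V^{\oplus n})$; $\mathbb Z/2\otimes_{GL_n}P_{\mathbb A}H_d(V^{\oplus n})$ denotes the space of $GL_n$-coinvariants. *)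

(* Defs.v *)
From HB Require Import structures.
From mathcomp Require Import all_boot all_order all_algebra.
From mathcomp Require Import ring_quotient.
From mathcomp Require Import mpoly.

Set Implicit Arguments.
Unset Strict Implicit.
Unset Printing Implicit Defensive.

Import GRing.Theory.
Local Open Scope ring_scope.

Lemma F2_sqr (c : 'F_2) : c ^+ 2 = c.
Proof.
by apply: val_inj; case: c => [[|[|x]] ltx].
Qed.

Lemma mpoly_rmorph_ext (n : nat) (R : comNzRingType) (S : pzRingType)
    (f g : {rmorphism {mpoly R[n]} -> S}) :
  (forall c, f c%:MP = g c%:MP) -> (forall i, f 'X_i = g 'X_i) -> f =1 g.
Proof.
move=> eqC eqX; elim/mpolyind => [|c m p _ _ IH]; first by rewrite !rmorph0.
rewrite !rmorphD IH -mul_mpolyC !rmorphM eqC; congr (_ * _ + _).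
rewrite mpolyXE_id !rmorph_prod; apply: eq_bigr => i _.
by rewrite !rmorphXn eqX.
Qed.

(* The total square f |-> \sum_k Sq^k(f) T^k is the ring morphism from         *)
(* F_2[u_1, ..., u_n] to F_2[u_1, ..., u_n][T] that maps u_i to u_i + u_i^2 T; *)
(* its multiplicativity is the Cartan formula.                                *)
Section SteenrodSquares.
Variable n : nat.
Implicit Types (f g : {mpoly 'F_2[n]}) (k d e : nat).

Definition total_sq : {mpoly 'F_2[n]} -> {poly {mpoly 'F_2[n]}} :=
  mmap (polyC \o @mpolyC n 'F_2)
       (fun i => ('X_i)%:P + ('X_i ^+ 2)%:P * 'X).

HB.instance Definition _ := GRing.RMorphism.on total_sq.

Definition Sq k f : {mpoly 'F_2[n]} := (total_sq f)`_k.

Lemma total_sqC (c : 'F_2) : total_sq c%:MP = c%:MP%:P.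
Proof. by rewrite /total_sq mmapC. Qed.

Lemma total_sqXU i : total_sq 'X_i = ('X_i)%:P + ('X_i ^+ 2)%:P * 'X.
Proof. by rewrite /total_sq mmapX mmap1U. Qed.

Fact Sq_is_linear k : linear (Sq k).
Proof.
move=> c f g; rewrite /Sq rmorphD coefD -mul_mpolyC rmorphM /= total_sqC.
by rewrite coefCM mul_mpolyC.
Qed.

HB.instance Definition _ k :=
  GRing.isLinear.Build 'F_2 {mpoly 'F_2[n]} {mpoly 'F_2[n]} _ (Sq k)
    (Sq_is_linear k).

Lemma Sq_Cartan k f g : Sq k (f * g) = \sum_(i < k.+1) Sq i f * Sq (k - i) g.
Proof. by rewrite /Sq rmorphM coefM. Qed.

Lemma Sq1_XU i : Sq 1 'X_i = 'X_i ^+ 2.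
Proof. by rewrite /Sq total_sqXU coefD coefC coefCM coefX mulr1 add0r. Qed.

Lemma Sq_XU k i : (1 < k)%N -> Sq k 'X_i = 0.
Proof.
by case: k => [|[|k]] // _; rewrite /Sq total_sqXU coefD coefC coefCM coefX
  mulr0 addr0.
Qed.

Lemma Sq0 f : Sq 0 f = f.
Proof.
rewrite /Sq -horner_coef0.
apply: (mpoly_rmorph_ext (f := horner_eval 0 \o total_sq) (g := idfun)).
  by move=> c; rewrite /= total_sqC /horner_eval hornerC.
move=> i; rewrite /= total_sqXU /horner_eval.
by rewrite hornerD hornerM !hornerC hornerX mulr0 addr0.
Qed.

Lemma Sq_homog k e d f :
  (e + k)%N = d -> f \is e.-homog -> Sq k f \is d.-homog.
Proof.
move=> <- {d} /dhomogP fP; rewrite [f]mpolyE linear_sum big_seq.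
apply: rpred_sum => m /fP /= <-; rewrite linearZ; apply: rpredZ.
pose Q a (p : {poly {mpoly 'F_2[n]}}) := forall k, p`_k \is (a + k).-homog.
have Q1 : Q 0%N 1.
  by move=> [|j]; rewrite coef1 ?dhomog1 ?dhomog0.
have QM a b p q : Q a p -> Q b q -> Q (a + b)%N (p * q).
  move=> Qp Qq j; rewrite coefM; apply: rpred_sum => i _.
  have -> : (a + b + j = (a + i) + (b + (j - i)))%N.
    by rewrite addnACA subnKC // -ltnS.
  exact: dhomogM.
have QX i : Q 1%N (total_sq 'X_i).
  move=> j; rewrite total_sqXU coefD coefC coefCM coefX; apply: rpredD.
    by case: j => [|j] /=; rewrite ?dhomog0 // dhomogX /= mdeg1.
  case: j => [|[|j]] /=; rewrite ?mulr0 ?dhomog0 // mulr1.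
  by rewrite expr2; apply: (@dhomogM _ _ mdeg 1 _ 1); rewrite dhomogX /= mdeg1.
suff: Q (mdeg m) (total_sq 'X_[m]) by apply.
rewrite mpolyXE_id rmorph_prod mdegE.
apply: (big_ind2 Q) => // [|i _]; first by move=> a p b q; exact: QM.
rewrite rmorphXn.
elim: (m i) => [|j IH] //; rewrite exprS -add1n; exact: QM.
Qed.

End SteenrodSquares.

Section Substitution.
Variable n : nat.
Implicit Types (g h : 'M['F_2]_n) (f : {mpoly 'F_2[n]}).

(* u_i |-> \sum_j g_ij u_j *)
Definition lin_subst g : {mpoly 'F_2[n]} -> {mpoly 'F_2[n]} :=
  comp_mpoly [tuple \sum_j g i j *: 'X_j | i < n].

HB.instance Definition _ g := GRing.LRMorphism.on (lin_subst g).

Lemma lin_substXU g i : lin_subst g 'X_i = \sum_j g i j *: 'X_j.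
Proof. by rewrite /lin_subst comp_mpolyXU -tnth_nth tnth_mktuple. Qed.

Lemma lin_subst1 f : lin_subst 1%:M f = f.
Proof.
apply: (mpoly_rmorph_ext (f := lin_subst 1%:M) (g := idfun)) => [c|i].
  exact: comp_mpolyC.
rewrite /= lin_substXU (bigD1 i) //= mxE eqxx scale1r big1 ?addr0 // => j ne_ji.
by rewrite mxE eq_sym (negbTE ne_ji) scale0r.
Qed.

Lemma lin_substM g h f : lin_subst (g *m h) f = lin_subst h (lin_subst g f).
Proof.
apply: (mpoly_rmorph_ext (f := lin_subst (g *m h))
                         (g := lin_subst h \o lin_subst g)) => [c|i] /=.
  by rewrite /lin_subst !comp_mpolyC.
rewrite !lin_substXU linear_sum /=.
under eq_bigr => j _ do rewrite mxE scaler_suml.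
rewrite exchange_big; apply: eq_bigr => l _ /=.
rewrite linearZ /= lin_substXU scaler_sumr.
by apply: eq_bigr => j _; rewrite scalerA.
Qed.

Lemma lin_subst_homog g d f : f \is d.-homog -> lin_subst g f \is d.-homog.
Proof.
move=> /dhomogP fP; rewrite [f]mpolyE linear_sum big_seq.
apply: rpred_sum => m /fP /= <-; rewrite linearZ; apply: rpredZ.
rewrite /= mpolyXE_id rmorph_prod mdegE.
apply: (big_ind2 (fun e (p : {mpoly 'F_2[n]}) => p \is e.-homog)) => [|a p b q|i _].
- exact: dhomog1.
- exact: dhomogM.
have lin1 : lin_subst g 'X_i \is 1.-homog.
  rewrite lin_substXU; apply: rpred_sum => j _; apply: rpredZ.
  by rewrite dhomogX /= mdeg1.
by rewrite rmorphXn; have := dhomogMn (m i) lin1; rewrite mul1n.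
Qed.

Lemma Sq_lin_subst k g f : Sq k (lin_subst g f) = lin_subst g (Sq k f).
Proof.
suff E : total_sq (lin_subst g f) = map_poly (lin_subst g) (total_sq f).
  by rewrite /Sq E coef_map.
apply: (mpoly_rmorph_ext (f := @total_sq n \o lin_subst g)
          (g := map_poly (lin_subst g) \o @total_sq n)) => [c|i] /=.
  by rewrite {1}/lin_subst comp_mpolyC !total_sqC map_polyC /= /lin_subst comp_mpolyC.
rewrite total_sqXU rmorphD rmorphM /= !map_polyC map_polyX /= rmorphXn /=.
have char2 : 2%N \in [pchar {mpoly 'F_2[n]}].
  by rewrite (rmorph_pchar (@mpolyC n 'F_2)) // pchar_Fp.
have -> : (lin_subst g 'X_i) ^+ 2 = \sum_j g i j *: 'X_j ^+ 2.
  rewrite lin_substXU -(pFrobenius_autE char2) rmorph_sum.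
  apply: eq_bigr => j _; rewrite [LHS]pFrobenius_autE exprZn.
  by rewrite F2_sqr.
rewrite lin_substXU !rmorph_sum mulr_suml -big_split /=.
apply: eq_bigr => j _ /=.
rewrite -!mul_mpolyC rmorphM /= total_sqC total_sqXU.
by rewrite !polyCM mulrDr !mulrA.
Qed.

End Substitution.

(* multinomials makes [dhomog n R d] a [vectType] only for positive n; this   *)
(* alias is one for every n.                                                  *)
Definition cohomology (n d : nat) : Type := dhomog n 'F_2 d.

HB.instance Definition _ n d := GRing.Lmodule.on (cohomology n d).

Fact cohomology_vect_axiom n d :
  Vector.axiom 'C((d + n).-1, d) (cohomology n d).
Proof.
case: n => [|n]; last by rewrite addnS; exact: dhomog_vecaxiom.
have m0 (m m' : 'X_{1..0}) : m = m' by apply/mnmP; case.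
rewrite addn0; case: d => [|d] /=; last rewrite bin_small //.
  exists (fun p : cohomology 0 0 => const_mx (val p)@_0%MM).
    by move=> c p q; apply/rowP=> i; rewrite !mxE mcoeffD mcoeffZ.
  have h (v : 'rV['F_2]_1) : (v 0 0)%:MP_[0] \is 0.-homog.
    by rewrite -[_%:MP]mulr1 mul_mpolyC dhomogZ ?dhomog1.
  exists (fun v => DHomog (h v)) => [p|v].
    by apply/val_inj/mpolyP => m; rewrite /= mxE mcoeffC (m0 m 0%MM) eqxx mulr1.
  by apply/rowP => i; rewrite ord1 mxE /= mcoeffC eqxx mulr1.
exists (fun=> 0) => [c p q|]; first by apply/rowP; case.
exists (fun=> 0) => [p|v]; last by apply/rowP; case.
apply/val_inj/mpolyP => m; rewrite mcoeff0; apply/esym.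
by apply: dhomog_nemf_coeff (valP p) _; rewrite (m0 m 0%MM) /= mdeg0.
Qed.

HB.instance Definition _ n d :=
  Lmodule_hasFinDim.Build 'F_2 (cohomology n d) (cohomology_vect_axiom n d).

Definition homology (n d : nat) : vectType 'F_2 :=
  'Hom(cohomology n d, ('F_2)^o).

Section SteenrodAction.
Variables (n k e d : nat) (ekd : (e + k)%N = d).

Definition coh_Sq_fun (f : cohomology n e) : cohomology n d :=
  DHomog (Sq_homog ekd (valP f)).

Fact coh_Sq_is_linear : linear coh_Sq_fun.
Proof. by move=> c f g; apply: val_inj; exact: linearP. Qed.

HB.instance Definition _ :=
  GRing.isLinear.Build 'F_2 (cohomology n e) (cohomology n d) _ coh_Sq_fun
    coh_Sq_is_linear.

Definition coh_Sq : 'Hom(cohomology n e, cohomology n d) := linfun coh_Sq_fun.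

Definition dual_Sq_fun (x : homology n d) : homology n e := (x \o coh_Sq)%VF.

Fact dual_Sq_is_linear : linear dual_Sq_fun.
Proof.
move=> c x y; apply/lfunP=> f.
by rewrite /dual_Sq_fun comp_lfunE !add_lfunE !scale_lfunE !comp_lfunE.
Qed.

HB.instance Definition _ :=
  GRing.isLinear.Build 'F_2 (homology n d) (homology n e) _ dual_Sq_fun
    dual_Sq_is_linear.

Definition dual_Sq : 'Hom(homology n d, homology n e) := linfun dual_Sq_fun.

Lemma dual_SqE (x : homology n d) (f : cohomology n e) :
  dual_Sq x f = x (coh_Sq_fun f).
Proof. by rewrite lfunE /= comp_lfunE lfunE. Qed.

End SteenrodAction.

Section LinearAction.
Variables (n d : nat).
Implicit Types (g h : 'M['F_2]_n) (f : cohomology n d) (x : homology n d).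

Definition coh_act_fun g f : cohomology n d :=
  DHomog (lin_subst_homog g (valP f)).

Fact coh_act_is_linear g : linear (coh_act_fun g).
Proof. by move=> c f f'; apply: val_inj; exact: linearP. Qed.

HB.instance Definition _ g :=
  GRing.isLinear.Build 'F_2 (cohomology n d) (cohomology n d) _ (coh_act_fun g)
    (coh_act_is_linear g).

Definition coh_act g : 'End(cohomology n d) := linfun (coh_act_fun g).

(* (g x)(f) = x(f o g), a left action *)
Definition hom_act_fun g x : homology n d := (x \o coh_act g)%VF.

Fact hom_act_is_linear g : linear (hom_act_fun g).
Proof.
move=> c x y; apply/lfunP=> f.
by rewrite /hom_act_fun comp_lfunE !add_lfunE !scale_lfunE !comp_lfunE.
Qed.

HB.instance Definition _ g :=
  GRing.isLinear.Build 'F_2 (homology n d) (homology n d) _ (hom_act_fun g)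
    (hom_act_is_linear g).

Definition hom_act g : 'End(homology n d) := linfun (hom_act_fun g).

Lemma hom_actE g x f : hom_act g x f = x (coh_act_fun g f).
Proof. by rewrite lfunE /= comp_lfunE lfunE. Qed.

Lemma hom_act1 x : hom_act 1%:M x = x.
Proof.
apply/lfunP=> f; rewrite hom_actE; congr (x _).
by apply: val_inj; exact: lin_subst1.
Qed.

Lemma hom_actM g h x : hom_act (g *m h) x = hom_act g (hom_act h x).
Proof.
apply/lfunP=> f; rewrite !hom_actE; congr (x _).
by apply: val_inj; exact: lin_substM.
Qed.

End LinearAction.

Section PrimitiveElements.
Variables (n d : nat).

(* Sq^(k+1) : H^(d-k-1) -> H^d for k < d; the dual of a square of degree      *)
(* larger than d has source H_d and target 0. See memPA.                      *)
Definition PA : {vspace homology n d} :=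
  (\bigcap_(k < d) lker (dual_Sq n (subnK (ltn_ord k))))%VS.

Lemma memPA (x : homology n d) :
  reflect (forall (k e : nat) (ekd : (e + k)%N = d) (f : cohomology n e),
             (0 < k)%N -> x (coh_Sq_fun ekd f) = 0)
          (x \in PA).
Proof.
apply: (iffP idP) => [xP [|k] e ekd f // _ | xP].
  have lt_k : (k < d)%N by rewrite -ekd leq_addl.
  have := subv_trans xP (bigcapv_inf (Ordinal lt_k) isT (subvv _)).
  rewrite -memvE memv_ker => /eqP /lfunP xSq.
  have e_dk : e = (d - k.+1)%N by rewrite -ekd addnK.
  move: ekd f; rewrite e_dk => ekd f; have := xSq f.
  rewrite dual_SqE zero_lfunE => <-; congr (x _); exact: val_inj.
apply/subv_bigcapP => k _; rewrite -memvE memv_ker; apply/eqP/lfunP => f.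
by rewrite dual_SqE zero_lfunE; exact: xP.
Qed.

Lemma PA_stable (g : 'M['F_2]_n) x : x \in PA -> hom_act d g x \in PA.
Proof.
move=> /memPA xP; apply/memPA => k e ekd f k_gt0; rewrite hom_actE.
rewrite -(xP k e ekd (coh_act_fun g f) k_gt0); congr (x _).
by apply: val_inj; rewrite /= Sq_lin_subst.
Qed.

Definition PA_act_fun (g : 'M['F_2]_n) (x : subvs_of PA) : subvs_of PA :=
  Subvs (PA_stable g (subvsP x)).

Fact PA_act_is_linear g : linear (PA_act_fun g).
Proof. by move=> c x y; apply: val_inj; exact: linearP. Qed.

HB.instance Definition _ g :=
  GRing.isLinear.Build 'F_2 (subvs_of PA) (subvs_of PA) _ (PA_act_fun g)
    (PA_act_is_linear g).

Definition PA_act (g : 'M['F_2]_n) : 'End(subvs_of PA) := linfun (PA_act_fun g).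

End PrimitiveElements.

Arguments PA_act : clear implicits.

Section Coinvariants.
Variables (n : nat) (V : vectType 'F_2) (rho : 'M['F_2]_n -> 'End(V)).

(* the span of all rho g v - v with g in GL_n *)
Definition GL_relations : {vspace V} :=
  (\sum_(g : 'M['F_2]_n | g \in unitmx) limg (rho g - \1%VF))%VS.

(* quotient of additive groups; [{ideal_quot _}] needs no ideal property here *)
Definition GL_coinvariants : zmodType := {ideal_quot GL_relations}.

End Coinvariants.

(* Main.v *)
(* The coinvariants of P_A H_d vanish iff its dual F_2 (x)_A H^d has no nonzero
   invariant: if X (g f) = X f for all g in GL_n and all linear functionals X
   killing the hits, then X f = 0 for all these X.

   Degree reduction. By the chi-trick (u * Sq^k v = chi(Sq^k) u * v modulo hits)
   a product of r linear factors times h^2 is hit unless its degree plus r is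
   twice a sum of r powers of 2. In degree d_{t+1} = 2 d_t + 5 this never happens
   for r < 5, so every monomial with an even exponent is hit. Kameko's map
   u_1...u_5 h^2 |-> h then carries invariants from degree d_{t+1} to degree d_t,
   which leaves the degree d_0 = 50.

   Degree 50. Over F_32 the linear forms v_j = sum_l q_l^(2^j) u_l (q a basis)
   satisfy Sq v_j = v_j + v_{j-1}^2. An invariant is fixed by the normalizer of a
   Singer cycle (of order 31 * 5), so it can be tested on functionals in the v_j
   averaged over that group: these vanish on monomials of weight sum a_j 2^j prime
   to 31 and are constant on cyclic shifts of the exponents. Hit equations express
   all of them through their values at 20 shift-orbits, so an invariant f is given
   by 20 unknown coefficients. One explicit functional y, averaged after each of 21
   permutations of the variables, gives 21 linear forms in these unknowns which
   all take the value y(f). The 20 unit vectors are sums of an even number of the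
   21 forms, so all the unknowns vanish. *)
From HB Require Import structures.
Require Import Defs.
From mathcomp Require Import all_boot all_order all_algebra all_fingroup.
From mathcomp Require Import ring_quotient.
From mathcomp Require Import mpoly ssrcomplements zify.

Set Implicit Arguments.
Unset Strict Implicit.
Unset Printing Implicit Defensive.

Import GRing.Theory.
Local Open Scope ring_scope.

(** * Total squares *)

Section TwistedSquare.
Variables (R : comNzRingType) (n : nat) (s : {perm 'I_n}).

(* The usual total square has [s = 1]; a cyclic shift [s] is its expression in
   the coordinates v_j over F_(2^n). *)
Definition tsq : {mpoly R[n]} -> {poly {mpoly R[n]}} :=
  mmap (polyC \o @mpolyC n R)
       (fun i => ('X_i)%:P + ('X_(s i) ^+ 2)%:P * 'X).

HB.instance Definition _ := GRing.RMorphism.on tsq.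

Lemma tsqC c : tsq c%:MP = c%:MP%:P.
Proof. by rewrite /tsq mmapC. Qed.

Lemma tsqXU i : tsq 'X_i = ('X_i)%:P + ('X_(s i) ^+ 2)%:P * 'X.
Proof. by rewrite /tsq mmapX mmap1U. Qed.

Lemma tsq_coef0 h : (tsq h)`_0 = h.
Proof.
pose f1 : {rmorphism {mpoly R[n]} -> {mpoly R[n]}} := coefp 0 \o tsq.
apply: (mpoly_rmorph_ext (f := f1) (g := idfun)) => [c|i].
  by apply: etrans (congr1 (coefp 0) (tsqC c)) _; rewrite /= coefC.
apply: etrans (congr1 (coefp 0) (tsqXU i)) _.
by rewrite /= coefD coefMX !coefC addr0.
Qed.

Lemma coef_tsqD k h h' : (tsq (h + h'))`_k = (tsq h)`_k + (tsq h')`_k.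
Proof. by rewrite rmorphD coefD. Qed.

Lemma coef_tsqZ k c h : (tsq (c *: h))`_k = c *: (tsq h)`_k.
Proof. by rewrite -mul_mpolyC rmorphM /= tsqC coefCM mul_mpolyC. Qed.

End TwistedSquare.

Lemma total_sq_tsq n h : @total_sq n h = tsq 1%g h.
Proof.
apply: (mpoly_rmorph_ext (f := @total_sq n) (g := tsq 1%g)) => [c|i] /=.
  by rewrite total_sqC tsqC.
by rewrite total_sqXU tsqXU perm1.
Qed.

Section Char2.
Variables (R : comNzRingType).
Hypothesis (char2 : 2%N \in [pchar R]).

Lemma sqrD_char2 (a b : R) : (a + b) ^+ 2 = a ^+ 2 + b ^+ 2.
Proof. by rewrite -!(pFrobenius_autE char2) rmorphD. Qed.

Lemma sqr_sum_char2 I (r : seq I) (F : I -> R) :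
  (\sum_(i <- r) F i) ^+ 2 = \sum_(i <- r) F i ^+ 2.
Proof.
by apply: (big_morph (fun a : R => a ^+ 2)); [exact: sqrD_char2 | rewrite expr0n].
Qed.

Lemma exprD_pow2 (a b : R) k : (a + b) ^+ (2 ^ k) = a ^+ (2 ^ k) + b ^+ (2 ^ k).
Proof.
elim: k => [|k IH]; first by rewrite !expr1.
by rewrite expnSr !exprM IH sqrD_char2.
Qed.

Lemma addrr_char2 (a : R) : a + a = 0.
Proof. by rewrite addrr_pchar2. Qed.

Lemma coef_sqr_char2 (p : {poly R}) k :
  (p ^+ 2)`_k = if odd k then 0 else p`_k./2 ^+ 2.
Proof.
elim/poly_ind: p k => [|p c IH] k.
  by rewrite expr0n /= !coef0 expr0n /= if_same.
have cP : 2%N \in [pchar {poly R}] by rewrite pchar_poly.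
have -> : (p * 'X + c%:P) ^+ 2 = p ^+ 2 * 'X^2 + (c ^+ 2)%:P.
  by rewrite -[LHS](pFrobenius_autE cP) rmorphD /= !pFrobenius_autE exprMn rmorphXn.
rewrite !coefD coefMXn !coefC coefMX.
case: k => [|[|k]] /=; rewrite ?addr0 ?add0r //.
by rewrite subn2 /= IH negbK.
Qed.

End Char2.

Section Monomials.
Variables (n : nat).
Implicit Types (m : 'X_{1..n}) (E : seq 'I_n).

Definition mhalf m : 'X_{1..n} := [multinom (m i)./2 | i < n].
Lemma mhalfE m i : mhalf m i = (m i)./2. Proof. by rewrite mnmE. Qed.
Definition modds m : seq 'I_n := [seq i <- enum 'I_n | odd (m i)].
Definition XE (R : comNzRingType) E : {mpoly R[n]} := \prod_(i <- E) 'X_i.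

(** Each exponent is its last binary digit plus twice the rest. The chi-trick, the descent and the
    Kameko map all work on this product of distinct variables times a square. *)
Lemma mpolyX_half (R : comNzRingType) m :
  'X_[m] = XE R (modds m) * 'X_[mhalf m] ^+ 2.
Proof.
rewrite /XE /modds big_filter big_enum_cond big_mkcond /= !mpolyXE_id -prodrXl.
rewrite -big_split /=; apply: eq_bigr => i _; rewrite mnmE -exprM muln2.
rewrite -{1}(odd_double_half (m i)) exprD.
by case: (odd (m i)).
Qed.

Lemma mdeg_half m : (mdeg m = size (modds m) + (mdeg (mhalf m)).*2)%N.
Proof.
rewrite !mdegE /modds size_filter -sum1_count big_enum_cond /= [X in (X + _)%N]big_mkcond /=.
rewrite -muln2 big_distrl -big_split /=; apply: eq_bigr => i _.
by rewrite mnmE muln2 -{1}(odd_double_half (m i)); case: odd.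
Qed.

End Monomials.

(** * Functionals killing the hits, and the chi-trick *)

Section HitFunctionals.
Variables (F : comNzRingType) (n : nat) (s : {perm 'I_n}) (A : zmodType).
Hypothesis F_le1 : forall c : F, c = 0 \/ c = 1.
Local Notation P := {mpoly F[n]}.
Implicit Types (x : {additive P -> A}) (f h : P) (m : 'X_{1..n}) (E : seq 'I_n).

Lemma pchar_mpoly2 : 2%N \in [pchar P].
Proof.
rewrite (rmorph_pchar (@mpolyC n F)) // !inE /=.
case: (F_le1 2%:R) => [->|/eqP]; first exact: eqxx.
by rewrite -subr_eq0 (natrD _ 1 1) addrK oner_eq0.
Qed.

(** Scalars are 0 or 1, so every polynomial is a plain sum of monomials and additive maps can be
    compared on monomials. *)
Lemma mpoly_ind01 (Q : P -> Prop) :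
  Q 0 -> (forall h h', Q h -> Q h' -> Q (h + h')) -> (forall m, Q 'X_[m]) ->
  forall h, Q h.
Proof.
move=> Q0 QD QX; elim/mpolyind => [//|c m p _ _ Qp]; apply: QD => //.
by case: (F_le1 c) => ->; rewrite ?scale0r ?scale1r.
Qed.

(** For [s = 1], [A = F] and support in a single degree [d], these are the elements of $P_{\mathbb
    A}H_d$; the cyclic shift [s] serves the coordinates v_j. *)
Definition kills_hits (x : P -> A) :=
  forall k h, (0 < k)%N -> x (tsq s h)`_k = 0.

Definition concentrated d (x : P -> A) := forall m, mdeg m != d -> x 'X_[m] = 0.

(** [E] may have repetitions. This lets the condition pass from [x] to [premul x 'X_j] with [r]
    lowered by one. *)
Definition kills_fewer_odd r (x : P -> A) :=
  forall E h, (size E < r)%N -> x (XE F E * h ^+ 2) = 0.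

(** On a class of degree k the operation Sq^k is squaring; here the twist moves the variables by
    [s], hence the permuted exponents. It writes the square of a monomial as a Steenrod square, to
    which the chi-trick can be applied. *)
Lemma tsqX_top m :
  (tsq s 'X_[[multinom m (s j) | j < n]])`_(mdeg m) = 'X_[m] ^+ 2 :> P.
Proof.
pose top b (p : {poly P}) t := (size p <= b.+1)%N /\ p`_b = t.
have top1 : top 0%N 1 1 by split; rewrite ?size_poly1 ?coef1.
have topM b c p q t u : top b p t -> top c q u -> top (b + c)%N (p * q) (t * u).
  move=> [sp <-] [sq <-]; split.
    rewrite (leq_trans (size_polyMleq _ _)) // -subn1 leq_subLR.
    by rewrite (leq_trans (leq_add sp sq)) // addSn addnS add1n.
  rewrite coefM (bigD1 (inord b)) //= big1 ?addr0 => [|i].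
    by rewrite inordK ?addKn // ltnS leq_addr.
  rewrite -val_eqE /= inordK ?ltnS ?leq_addr // neq_ltn => /orP[lt_ib|lt_bi].
    rewrite (@nth_default _ _ q) ?mulr0 // (leq_trans sq) // ltn_subRL.
    by rewrite ltn_add2r.
  by rewrite nth_default ?mul0r // (leq_trans sp).
have topXU i : top 1%N (tsq s 'X_i) ('X_(s i) ^+ 2).
  rewrite tsqXU; split.
    rewrite (leq_trans (size_polyD _ _)) // geq_max.
    rewrite (leq_trans (size_polyC_leq1 _)) //=.
    rewrite (leq_trans (size_polyMleq _ _)) // size_polyX addnC /=.
    by rewrite ltnS size_polyC_leq1.
  by rewrite coefD coefC coefCM coefX mulr1 add0r.
suff: top (mdeg m) (tsq s 'X_[[multinom m (s j) | j < n]]) ('X_[m] ^+ 2) by case.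
have -> : mdeg m = (\sum_i m (s i))%N.
  by rewrite mdegE (reindex_inj (@perm_inj _ s)).
rewrite !mpolyXE_id -prodrXl rmorph_prod.
rewrite [X in top _ _ X](reindex_inj (@perm_inj _ s)) /=.
have bigtop (r : seq 'I_n) : top (\sum_(i <- r) m (s i))%N
    (\prod_(i <- r) tsq s ('X_i ^+ [multinom m (s j) | j < n] i))
    (\prod_(i <- r) ('X_(s i) ^+ m (s i)) ^+ 2).
  elim: r => [|i r IH]; first by rewrite !big_nil.
  rewrite !big_cons; apply: (topM) => {IH}//.
  rewrite mnmE rmorphXn exprAC.
  elim: (m (s i)) => [|k IH]; first by rewrite !expr0.
  by rewrite -add1n !exprD !expr1; exact: topM (topXU i) IH.
exact: bigtop.
Qed.

(* chi(Sq) u_i up to degree 2^N: tsq_ext, the total square fixing the formal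
   variable, sends it to u_i up to a term of high degree. *)
Definition chiX N i : {poly P} :=
  \sum_(k < N) ('X_((s ^+ k)%g i) ^+ (2 ^ k))%:P * 'X^(2 ^ k - 1).

Definition tsq_ext : {poly P} -> {poly P} := horner_eval 'X \o map_poly (tsq s).

HB.instance Definition _ := GRing.RMorphism.on tsq_ext.

Lemma coef_tsq_ext (H : {poly P}) k :
  (tsq_ext H)`_k = \sum_(i < k.+1) (tsq s H`_i)`_(k - i).
Proof.
have sz : (size (map_poly (tsq s) H) <= size H + k.+1)%N.
  exact: leq_trans (size_poly _ _) (leq_addr _ _).
rewrite /tsq_ext /= /horner_eval (horner_coef_wide _ sz) coef_sum.
rewrite [RHS](big_ord_widen _ (fun i => (tsq s H`_i)`_(k - i)) (leq_addl (size H) _)).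
rewrite [RHS]big_mkcond; apply: eq_bigr => i _ /=.
by rewrite coefMXn coef_map ltnS [(k < i)%N]ltnNge; case: leqP.
Qed.

Lemma tsq_extC h : tsq_ext h%:P = tsq s h.
Proof. by rewrite /tsq_ext /= map_polyC /horner_eval hornerC. Qed.

Lemma tsq_extX : tsq_ext 'X = 'X.
Proof. by rewrite /tsq_ext /= map_polyX /horner_eval hornerX. Qed.

(** The sum telescopes: the k-th term maps to the k-th plus the (k+1)-st term, and equal terms
    cancel in characteristic 2. *)
Lemma tsq_ext_chiX N i :
  tsq_ext (chiX N i) =
    ('X_i)%:P + ('X_((s ^+ N)%g i) ^+ (2 ^ N))%:P * 'X^(2 ^ N - 1).
Proof.
have cP : 2%N \in [pchar {poly P}] by rewrite pchar_poly pchar_mpoly2.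
elim: N => [|N IH].
  rewrite /chiX big_ord0 rmorph0 expg0 perm1 !expr1 expr0 mulr1.
  by rewrite (addrr_char2 cP).
rewrite /chiX big_ord_recr /= rmorphD /= -/(chiX N i) IH rmorphM /=.
rewrite [tsq_ext 'X^_]rmorphXn /= tsq_extX tsq_extC [tsq s _]rmorphXn /= tsqXU.
rewrite (exprD_pow2 cP) mulrDl -[(_)%:P ^+ _]rmorphXn /= addrA.
rewrite -[X in X + _ = _]addrA (addrr_char2 cP) addr0.
congr (_ + _); rewrite exprMn -rmorphXn /= -mulrA -exprD -exprM -expnS.
rewrite -permM -expgSr; congr (_ * 'X^_).
by rewrite expnS mul2n -addnn addnBA // expn_gt0.
Qed.

(** A factor [chiX N i] lives in the degrees [2 ^ l - 1]. Adding 1 for each factor turns the total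
    degree into a sum of powers of 2. *)
Lemma coef_prod_chiX N E k :
  (\prod_(i <- E) chiX N i)`_k != 0 ->
  exists2 ks, size ks = size E & (\sum_(j <- ks) 2 ^ j = k + size E)%N.
Proof.
elim: E k => [|i E IH] k.
  rewrite big_nil coef1; case: k => [_|k]; last by rewrite eqxx.
  by exists [::]; rewrite ?big_nil.
rewrite big_cons coefM => /eqP nz.
have /existsP[j] : [exists j : 'I_k.+1,
    ((chiX N i)`_j != 0) && ((\prod_(i <- E) chiX N i)`_(k - j) != 0)].
  apply: contraPT nz => /existsPn z; apply; apply: big1 => j _.
  have := z j; rewrite negb_and !negbK => /orP[]/eqP->; rewrite ?mul0r ?mulr0 //.
case/andP => nzj /IH[ks szks sumks].
have [l jl] : exists l, j = (2 ^ l - 1)%N :> nat.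
  move: nzj; rewrite /chiX coef_sum => /eqP nzj.
  have /existsP[l] : [exists l : 'I_N, j == (2 ^ l - 1)%N :> nat].
    apply: contraPT nzj => /existsPn z; apply; apply: big1 => l _.
    by rewrite coefCM coefXn (negbTE (z l)) mulr0.
  by move/eqP; exists l.
exists (l :: ks); rewrite /= ?szks // big_cons sumks.
have : (j <= k)%N by rewrite -ltnS.
by rewrite jl; have := expn_gt0 2 l; lia.
Qed.

(** The exact form of the chi-trick, u Sq^k h = sum of Sq^(k-i) applied to chi(Sq^i)(u) h. It
    compares coefficients in the total square of the chi-series of u times [h]. *)
Lemma XE_tsq_coef E h k :
  XE F E * (tsq s h)`_k =
    \sum_(i < k.+1) (tsq s ((\prod_(j <- E) chiX k.+1 j)`_i * h))`_(k - i).
Proof.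
set X := \prod_(j <- E) chiX k.+1 j.
transitivity (tsq_ext (X * h%:P))`_k; last first.
  by rewrite coef_tsq_ext; apply: eq_bigr => i _; rewrite coefMC.
rewrite rmorphM /= tsq_extC.
(* Truncating the chi-series at [k.+1] suffices: the error starts in degree [2 ^ k.+1 - 1], which
   exceeds [k]. *)
have [q ->] : exists q, tsq_ext X = (XE F E)%:P + q * 'X^(2 ^ k.+1 - 1).
  rewrite /X /XE; elim: E {X} => [|j E [q IH]].
    by exists 0; rewrite !big_nil rmorph1 mul0r addr0.
  rewrite !big_cons rmorphM /= tsq_ext_chiX IH polyCM.
  set T := 'X^_; set w := (_ ^+ _)%:P; set e := (\prod_(i <- E) 'X_i)%:P.
  exists (('X_j)%:P * q + w * e + w * T * q).
  rewrite mulrDl !mulrDr !mulrDl !mulrA -!addrA.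
  by rewrite ![_ * T * _]mulrAC.
rewrite mulrDl coefD coefCM mulrAC coefMXn.
by rewrite ltn_subRL add1n ltn_expl // addr0.
Qed.

(** With k the degree of [m], the terms with [i < k] are hits. The term [i = k] contains the
    chi-coefficient of degree k, which vanishes unless [size E + mdeg m] is a sum of [size E] powers
    of 2. *)
Lemma chi_trick x E m :
  kills_hits x ->
  (forall ks, size ks = size E -> \sum_(j <- ks) 2 ^ j != size E + mdeg m)%N ->
  x (XE F E * 'X_[m] ^+ 2) = 0.
Proof.
move=> xh no_sum; rewrite -tsqX_top; set h := 'X_[_]; set k := mdeg m.
rewrite XE_tsq_coef raddf_sum big1 // => i _; have := ltn_ord i; rewrite ltnS leq_eqVlt.
case/predU1P => [ik|lt_ik]; last by apply: xh; rewrite subn_gt0.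
case: (eqVneq (\prod_(j <- E) chiX k.+1 j)`_i 0) => [->|].
  by rewrite mul0r rmorph0 coef0 raddf0.
by case/coef_prod_chiX=> ks szks sumks; have := no_sum ks szks; rewrite sumks ik addnC eqxx.
Qed.

Definition premul x (e : P) : P -> A := fun h => x (e * h).

Fact premul_is_additive x e : nmod_morphism (premul x e).
Proof. by split=> [|h h']; rewrite /premul ?mulr0 ?raddf0 // mulrDr raddfD. Qed.

HB.instance Definition _ x e :=
  Algebra.isNmodMorphism.Build P A (premul x e) (premul_is_additive x e).

(* The hypothesis is an argument because the additivity of the map, and so the
   instance below, depends on it. *)
Definition descend (_ : forall c : F, c = 0 \/ c = 1) x E : P -> A :=
  fun h => x (XE F E * h ^+ 2).

Fact descend_is_additive x E : nmod_morphism (descend F_le1 x E).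
Proof.
split=> [|h h']; rewrite /descend ?expr0n ?mulr0 ?raddf0 //.
by rewrite (sqrD_char2 (pchar_mpoly2)) mulrDr raddfD.
Qed.

HB.instance Definition _ x E :=
  Algebra.isNmodMorphism.Build P A (descend F_le1 x E) (descend_is_additive x E).

(** Every term of a positive square of the product has some linear factor replaced by the square of
    a variable, so fewer than [r] factors remain outside the square. *)
Lemma tsq_XE_coef r x E k h :
  kills_fewer_odd r x -> size E = r -> (0 < k)%N ->
  x ((tsq s (XE F E))`_k * h ^+ 2) = 0.
Proof.
elim: E r x k h => [|j E IH] r x k h xr szE k0; subst r.
  by rewrite /XE big_nil rmorph1 coef1 gtn_eqF // mul0r raddf0.
rewrite /XE big_cons rmorphM /= tsqXU; move w_: ('X_(s j) ^+ 2) => w.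
move hh_: (h ^+ 2) => hh.
rewrite mulrDl coefD coefCM -mulrA coefCM coefXM.
rewrite gtn_eqF // mulrDl raddfD -!mulrA.
transitivity (0 + 0 : A); last exact: addr0; congr (_ + _).
  have xjr : kills_fewer_odd (size E) (premul x 'X_j).
    move=> E' h' szE'; have := xr (j :: E') h' szE'.
    by rewrite /premul /XE big_cons -mulrA.
  by rewrite -hh_; exact: (IH (size E) (premul x 'X_j) k h xjr erefl k0).
rewrite mulrCA -w_ -hh_ -exprMn; case: k k0 => [//|[|k]] _ /=.
  by rewrite tsq_coef0; apply: xr.
by apply: (IH (size E)) => // E' h' lt'; apply: xr; apply: ltnW.
Qed.

Lemma coef_tsqM f h k :
  (tsq s (f * h))`_k =
    f * (tsq s h)`_k + \sum_(i < k) (tsq s f)`_i.+1 * (tsq s h)`_(k - i.+1) :> P.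
Proof.
rewrite rmorphM coefM big_ord_recl subn0; congr (_ * _ + _).
exact: tsq_coef0.
Qed.

Lemma coef_tsq_sqr h k :
  (tsq s (h ^+ 2))`_k = if odd k then 0 else (tsq s h)`_k./2 ^+ 2 :> P.
Proof. rewrite rmorphXn; exact: coef_sqr_char2 (pchar_mpoly2) _ _. Qed.

Lemma coef_tsq_sqr_double h k : (tsq s h)`_k ^+ 2 = (tsq s (h ^+ 2))`_k.*2 :> P.
Proof. by have := coef_tsq_sqr h k.*2; rewrite odd_double doubleK => /esym. Qed.

Lemma tsq_mul_sqr x f h k :
  (forall i j g, (0 < i)%N -> x ((tsq s f)`_i * (tsq s g)`_j ^+ 2) = 0) ->
  x (tsq s (f * h ^+ 2))`_k = x (f * (tsq s (h ^+ 2))`_k).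
Proof.
move=> xf; have /(congr1 x) -> := coef_tsqM f (h ^+ 2) k.
rewrite [LHS]raddfD [x (\sum_(i < _) _)]raddf_sum big1 ?addr0 // => i _.
apply: etrans (congr1 (premul x (tsq s f)`_i.+1) (coef_tsq_sqr h _)) _.
case: ifP => _; first by rewrite raddf0.
exact: xf.
Qed.

(** The square of Sq^k h is Sq^(2k) of [h ^+ 2]. By the Cartan formula its product with [XE F E]
    differs from a hit only by terms in which a positive square acts on [XE F E], and these are
    killed. *)
Lemma kills_hits_descend r x E :
  kills_hits x -> kills_fewer_odd r x -> size E = r ->
  kills_hits (descend F_le1 x E).
Proof.
move=> xh xr szE k h k0; rewrite /descend.
apply: etrans (congr1 (premul x (XE F E)) (coef_tsq_sqr_double h k)) _.
transitivity (x (tsq s (XE F E * h ^+ 2))`_k.*2).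
  apply/esym/tsq_mul_sqr => i j g i0; exact: tsq_XE_coef xr szE i0.
by apply: xh; rewrite double_gt0.
Qed.

(** When [size E + 2 * mdeg m = d], the number excluded in [chi_trick] doubles to [d + size E]. In
    other degrees concentration gives 0. *)
Lemma kills_fewer_oddP d r x :
  kills_hits x -> concentrated d x ->
  (forall ks, size ks < r -> (\sum_(j <- ks) 2 ^ j).*2 != d + size ks)%N ->
  kills_fewer_odd r x.
Proof.
move=> xh xd no_sum E h szE; elim/mpoly_ind01: h => [|h h' IH IH'|m].
- by rewrite expr0n mulr0 raddf0.
- by rewrite (sqrD_char2 (pchar_mpoly2)) mulrDr raddfD IH IH' addr0.
have [dE|nd] := eqVneq (size E + (mdeg m).*2)%N d; last first.
  have -> : XE F E * 'X_[m] ^+ 2 = 'X_[\sum_(i <- E) U_(i) + m *+ 2].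
    by rewrite /XE mprodXE mpolyXn -mpolyXD.
  apply: xd; apply: contra_neq nd => <-.
  by rewrite mdegD mdegMn mdeg_sum muln2 (eq_bigr (fun=> 1%N)) ?sum1_size // => i; rewrite mdeg1.
apply: chi_trick => // ks szks; have := no_sum ks; rewrite szks => /(_ szE).
by apply: contra_neq => ->; rewrite -dE doubleD addnAC addnn.
Qed.

End HitFunctionals.

(** * The Kameko map *)

Section LinearExtension.
Variables (R : comNzRingType) (n : nat) (V : lmodType R) (phi : 'X_{1..n} -> V).

Definition mlin (f : {mpoly R[n]}) : V := \sum_(m <- msupp f) f@_m *: phi m.

Lemma mlinwE k f : (msize f <= k)%N ->
  mlin f = \sum_(m : 'X_{1..n < k}) f@_m *: phi m.
Proof.
move=> le_fk; rewrite /mlin (big_mksub 'X_{1..n < k}) //=; first last.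
- by move=> m /msize_mdeg_lt /leq_trans; apply.
- exact: msupp_uniq.
by rewrite big_rmcond //= => i /memN_msupp_eq0 ->; rewrite scale0r.
Qed.

Fact mlin_is_linear : linear mlin.
Proof.
move=> c f g; pose k := maxn (msize (c *: f + g)) (maxn (msize f) (msize g)).
rewrite !(@mlinwE k) ?leq_max ?leqnn ?orbT // scaler_sumr -big_split /=.
by apply: eq_bigr => m _; rewrite mcoeffD mcoeffZ scalerDl scalerA.
Qed.

HB.instance Definition _ :=
  GRing.isLinear.Build R {mpoly R[n]} V _ mlin mlin_is_linear.

Lemma mlinX m : mlin 'X_[m] = phi m.
Proof. by rewrite /mlin msuppX big_seq1 mcoeffX eqxx scale1r. Qed.

End LinearExtension.

Section Kameko.
Variables (F : comNzRingType) (n : nat).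
Hypothesis F_le1 : forall c : F, c = 0 \/ c = 1.
Local Notation P := {mpoly F[n]}.
Implicit Types (f h : P) (m : 'X_{1..n}).

Definition kameko : P -> P :=
  mlin (fun m => if [forall i, odd (m i)] then 'X_[mhalf m] else 0 : P).

HB.instance Definition _ := GRing.Linear.on kameko.

Lemma kamekoX m :
  kameko 'X_[m] = if [forall i, odd (m i)] then 'X_[mhalf m] else 0.
Proof. exact: mlinX. Qed.

Lemma kamekoD f f' : kameko (f + f') = kameko f + kameko f'.
Proof. exact: raddfD. Qed.

(** [kameko] is linear over squares, like a Cartier operator, so it is determined by its values on
    products of distinct variables. *)
Lemma kameko_mul_sqr f h : kameko (f * h ^+ 2) = kameko f * h.
Proof.
elim/(@mpoly_ind01 F n F_le1): f h => [|f f' IH IH'|e] h.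
- by rewrite mul0r raddf0 mul0r.
- by rewrite mulrDl !raddfD /= IH IH' mulrDl.
elim/(@mpoly_ind01 F n F_le1): h => [|h h' IH IH'|m].
- by rewrite expr0n !mulr0 raddf0.
- by rewrite (sqrD_char2 (pchar_mpoly2 n F_le1)) !mulrDr raddfD /= IH IH'.
rewrite mpolyXn -mpolyXD !kamekoX.
have oddE i : odd ((e + m *+ 2)%MM i) = odd (e i).
  by rewrite mnmDE mulmnE muln2 oddD odd_double addbF.
rewrite (eq_forallb oddE).
case: ifP => [/forallP oe|_]; last by rewrite mul0r.
rewrite -mpolyXD; congr 'X_[_]; apply/mnmP => i.
by rewrite mnmDE !mhalfE mnmDE mulmnE muln2 halfD odd_double andbF doubleK.
Qed.

(** Fewer than [n] variables miss one, whose exponent is then even. This allows [tsq_XE_coef] to be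
    applied to [kameko] itself. *)
Lemma kameko_fewer_odd : kills_fewer_odd n kameko.
Proof.
move=> E h szE; rewrite kameko_mul_sqr.
have [i iE] : exists i, i \notin E.
  apply/existsP; rewrite -negb_forall; apply: contraL szE => /forallP allE.
  rewrite -leqNgt -[X in (X <= _)%N]card_ord (leq_trans _ (card_size E)) //.
  by apply: subset_leq_card; apply/subsetP => j _; exact: allE.
rewrite /XE mprodXE kamekoX; case: ifP => [/forallP/(_ i)|]; last by rewrite mul0r.
rewrite mnm_sumE big_seq big1 // => j jE; rewrite mnm1E; case: eqP => // ij.
by rewrite -ij jE in iE.
Qed.

Lemma kameko_XE_modds m : kameko (XE F (modds m)) = [forall i, odd (m i)]%:R.
Proof.
rewrite /XE mprodXE kamekoX.
have mE i : (\sum_(i <- modds m) U_(i))%MM i = odd (m i).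
  rewrite /modds big_filter big_enum_cond mnm_sumE /= big_mkcond (bigD1 i) //=.
  rewrite big1 ?addn0 => [|j ne_ji].
    by case: odd; rewrite ?mnm1E ?eqxx.
  by case: odd; rewrite // mnm1E (negbTE ne_ji).
rewrite (eq_forallb (fun i => congr1 odd (mE i))); under eq_forallb => i do rewrite oddb.
case: ifP => // _; rewrite -[RHS]mpolyX0; congr 'X_[_].
by apply/mnmP => i; rewrite mhalfE mE mnm0E; case: odd.
Qed.

(** Modulo terms with fewer than [n] odd factors, Sq^k acts only on the square part of a monomial,
    where it is 0 for odd k and the square of Sq^(k/2) for even k. Hence functionals killing hits
    pull back along [kameko] to such functionals. *)
Lemma kameko_tsq s k f :
  kameko (tsq s f)`_k = if odd k then 0 else (tsq s (kameko f))`_k./2.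
Proof.
elim/(@mpoly_ind01 F n F_le1): f => [|f f' IH IH'|m].
- by rewrite !rmorph0 !raddf0 !coef0 if_same raddf0.
- apply: etrans (congr1 kameko (coef_tsqD s k f f')) _.
  apply: etrans (kamekoD _ _) (etrans (congr2 +%R IH IH') _).
  apply: etrans (_ : _ = if odd k then 0 else (tsq s (kameko f + kameko f'))`_k./2) _.
    by case: odd; [exact: addr0 | exact/esym/coef_tsqD].
  exact (congr1 (fun z => if odd k then 0 else (tsq s z)`_k./2) (esym (kamekoD f f'))).
rewrite (mpolyX_half _ m) kameko_mul_sqr kameko_XE_modds.
have c2 := pchar_mpoly2 n F_le1.
rewrite tsq_mul_sqr // => [|i j g i0]; last first.
  apply: (@tsq_XE_coef F n s P (size (modds m)) kameko) => // E h szE.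
  apply: kameko_fewer_odd; rewrite (leq_trans szE) //.
  by rewrite size_filter (leq_trans (count_size _ _)) // size_enum_ord.
have [ok|ok] := boolP (odd k).
  transitivity (kameko (XE F (modds m) * 0)); last by rewrite mulr0 raddf0.
  congr (kameko (_ * _)); have := coef_tsq_sqr s F_le1 'X_[mhalf m] k.
  by rewrite ok.
transitivity (kameko (XE F (modds m) * (tsq s 'X_[mhalf m])`_k./2 ^+ 2)).
  congr (kameko (_ * _)); have := coef_tsq_sqr s F_le1 'X_[mhalf m] k.
  by rewrite (negbTE ok).
rewrite kameko_mul_sqr kameko_XE_modds.
by case: [forall i, _]; rewrite ?mul1r // !mul0r rmorph0 coef0.
Qed.

Lemma prod_linear_fewer_odd r (x : {additive P -> P}) (c : 'I_n -> 'I_n -> F) E :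
  kills_fewer_odd r x -> (size E < r)%N ->
  x (\prod_(i <- E) \sum_j c i j *: 'X_j) = 0.
Proof.
elim: E r x => [|i E IH] r x xr szE.
  by rewrite big_nil; have := xr [::] 1 szE; rewrite /XE big_nil mul1r expr1n.
rewrite big_cons mulr_suml raddf_sum big1 // => j _.
rewrite -scalerAl; case: (F_le1 (c i j)) => ->; first by rewrite scale0r raddf0.
rewrite scale1r; case: r xr szE => // r xr szE.
apply: (IH r (premul x 'X_j)) => // E' h szE' /=.
by have := xr (j :: E') h szE'; rewrite /XE big_cons -mulrA.
Qed.

End Kameko.

Section Substitution.
Variables (R : comNzRingType) (n : nat).
Implicit Types (f h : {mpoly R[n]}) (g : 'M[R]_n).

Definition msubst g : {mpoly R[n]} -> {mpoly R[n]} :=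
  comp_mpoly [tuple \sum_j g i j *: 'X_j | i < n].

HB.instance Definition _ g := GRing.LRMorphism.on (msubst g).

Lemma msubstXU g i : msubst g 'X_i = \sum_j g i j *: 'X_j.
Proof. by rewrite /msubst comp_mpolyXU -tnth_nth tnth_mktuple. Qed.

Lemma msubstD g h h' : msubst g (h + h') = msubst g h + msubst g h'.
Proof. exact: raddfD. Qed.

Lemma msubstM g (h : 'M[R]_n) f : msubst (g *m h) f = msubst h (msubst g f).
Proof.
apply: (mpoly_rmorph_ext (f := msubst (g *m h)) (g := msubst h \o msubst g)) => [c|i] /=.
  by rewrite /msubst !comp_mpolyC.
rewrite !msubstXU linear_sum /=.
under eq_bigr => j _ do rewrite mxE scaler_suml.
rewrite exchange_big; apply: eq_bigr => l _ /=.
rewrite linearZ /= msubstXU scaler_sumr.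
by apply: eq_bigr => j _; rewrite scalerA.
Qed.

Lemma msubst1 f : msubst 1%:M f = f.
Proof.
apply: (mpoly_rmorph_ext (f := msubst 1%:M) (g := idfun)) => [c|i].
  exact: comp_mpolyC.
rewrite /= msubstXU (bigD1 i) //= mxE eqxx scale1r big1 ?addr0 // => j ne_ji.
by rewrite mxE eq_sym (negbTE ne_ji) scale0r.
Qed.

End Substitution.

Section KamekoGL.
Variables (F : comUnitRingType) (n : nat).
Hypothesis F_le1 : forall c : F, c = 0 \/ c = 1.
Local Notation P := {mpoly F[n]}.
Implicit Types (f h : P) (g : 'M[F]_n).

(** Choosing one variable from each row gives all exponents odd only if the choice is surjective,
    hence a permutation. The sum is the determinant of [g], since signs are trivial in
    characteristic 2, and it is 1 as a unit. *)
Lemma kameko_msubst_full g : g \in unitmx ->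
  kameko (\prod_i \sum_j g i j *: 'X_j) = 1.
Proof.
move=> g_unit; rewrite bigA_distr_bigA raddf_sum /=.
have kE (u : {ffun 'I_n -> 'I_n}) :
  kameko (\prod_i (g i (u i) *: 'X_(u i))) =
    if injectiveb u then (\prod_i g i (u i))%:MP else 0.
  rewrite scaler_prod linearZ /= mprodXE kamekoX.
  have mE j : (\sum_i U_(u i))%MM j = #|[pred i | u i == j]|.
    rewrite mnm_sumE -sum1_card [RHS]big_mkcond; apply: eq_bigr => i _.
    by rewrite mnm1E inE; case: eqP.
  have [u_inj|u_inj] := boolP (injectiveb u).
    have [v uK vK] := injF_bij (injectiveP _ u_inj).
    have mE1 j : (\sum_i U_(u i))%MM j = 1%N.
      rewrite mE (eq_card1 (x := v j)) // => i; rewrite !inE.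
      by apply/eqP/eqP => [<-|->].
    have -> : [forall i, odd ((\sum_i U_(u i))%MM i)].
      by apply/forallP => j; rewrite mE1.
    rewrite -alg_mpolyC -mpolyX0; congr (_ *: 'X_[_]).
    by apply/mnmP => j; rewrite mhalfE mE1 mnm0E.
  case: ifP => [/forallP ou|]; last by rewrite scaler0.
  case/negP: u_inj; apply/injectiveP.
  have usurj j : exists i, u i == j.
    have := ou j; rewrite mE; case: (pickP [pred i | u i == j]) => [i ui|/eq_card0-> //].
    by exists i.
  have im : codom u =i predT.
    by move=> j; have [i /eqP <-] := usurj j; rewrite codom_f.
  have /image_injP u_inj : #|codom u| == #|'I_n| by rewrite (eq_card im).
  by move=> i j; exact: u_inj.
rewrite (eq_bigr _ (fun u _ => kE u)) -big_mkcond /=.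
rewrite (reindex (fun s : 'S_n => pval s)) /=; last first.
  have s0 : 'S_n := 1%g; exists (insubd s0) => u /= Uu; first exact: valKd.
  by rewrite insubdK.
rewrite (eq_bigr (fun s : 'S_n => ((-1) ^+ s * \prod_i g i (s i))%:MP)) => [|s _].
  rewrite (eq_bigl xpredT) => [|s]; last exact: (valP s).
  rewrite -raddf_sum -/(\det g) /=; have : \det g \is a GRing.unit := g_unit.
  by case: (F_le1 (\det g)) => -> //; rewrite unitr0.
congr (_%:MP); rewrite -[LHS]mul1r; congr (_ * _).
  case: (F_le1 (-1)) => [/eqP|->]; last by rewrite expr1n.
  by rewrite oppr_eq0 oner_eq0.
by apply: eq_bigr => i _; rewrite pvalE.
Qed.

(** A monomial with an even exponent becomes fewer than [n] linear forms times a square, and both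
    sides vanish. The other monomials reduce to [kameko_msubst_full]. *)
Lemma kameko_msubst g f : g \in unitmx ->
  kameko (msubst g f) = msubst g (kameko f).
Proof.
move=> g_unit; elim/(@mpoly_ind01 F n F_le1): f => [|f f' IH IH'|m].
- by rewrite !raddf0.
- by rewrite msubstD !kamekoD IH IH' msubstD.
rewrite (mpolyX_half _ m) (kameko_mul_sqr F_le1) kameko_XE_modds.
have LM h h' : msubst g (h * h') = msubst g h * msubst g h' by exact: rmorphM.
have LX h : msubst g (h ^+ 2) = msubst g h ^+ 2 by exact: rmorphXn.
rewrite LM LX (kameko_mul_sqr F_le1) LM [msubst g _%:R]rmorph_nat; congr (_ * _).
rewrite /XE rmorph_prod (eq_bigr _ (fun i _ => msubstXU g i)).
have [/forallP om|] := boolP [forall i, odd (m i)]; last first.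
  rewrite negb_forall => /existsP[i mi].
  apply: (prod_linear_fewer_odd F_le1 _ (r := n)); first exact: (kameko_fewer_odd F_le1).
  rewrite size_filter -[X in (_ < X)%N](size_enum_ord n) ltn_neqAle count_size.
  rewrite andbT -all_count; apply/allPn; exists i => //; exact: mem_enum.
rewrite /modds (eq_filter (a2 := xpredT)) ?filter_predT ?big_enum //=.
exact: kameko_msubst_full.
Qed.

End KamekoGL.

(** * Invariants modulo hits *)

Section InvariantClasses.
Variables (F : comUnitRingType) (n : nat).
Hypothesis F_le1 : forall c : F, c = 0 \/ c = 1.
Local Notation P := {mpoly F[n]}.

Definition invariant_class d (f : P) :=
  forall (X : {additive P -> F}) (g : 'M[F]_n),
    kills_hits 1%g X -> concentrated d X -> g \in unitmx -> X (msubst g f) = X f.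

(* For F = F_2 this says that F_2 (x)_A H^d has no nonzero GL_n-invariant. *)
Definition no_invariant_class d :=
  forall f, invariant_class d f ->
  forall X : {additive P -> F}, kills_hits 1%g X -> concentrated d X -> X f = 0.

(** Each [X] in degree [d.*2 + n] factors through [kameko] as a functional [Y] in degree [d]. The
    image [kameko f] is again an invariant class, because [Z \o kameko] kills hits whenever [Z]
    does. *)
Lemma kameko_step d :
  (forall ks, size ks < n ->
     (\sum_(j <- ks) 2 ^ j).*2 != d.*2 + n + size ks)%N ->
  no_invariant_class d -> no_invariant_class (d.*2 + n).
Proof.
move=> no_sum IH f f_inv X Xh Xd.
have X_odd : kills_fewer_odd n X := kills_fewer_oddP F_le1 Xh Xd no_sum.
have szE : size (enum 'I_n) = n by rewrite size_enum_ord.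
pose Y : {additive P -> F} := descend F_le1 X (enum 'I_n).
have X_desc : forall h, X h = Y (kameko h).
  elim/(@mpoly_ind01 F n F_le1) => [|h h' Eh Eh'|m].
  - by rewrite !raddf0.
  - by rewrite kamekoD (raddfD X) (raddfD Y) Eh Eh'.
  rewrite (mpolyX_half _ m) (kameko_mul_sqr F_le1) kameko_XE_modds.
  have [/forallP om|] := boolP [forall i, odd (m i)].
    rewrite mul1r /Y /descend /modds (eq_filter (a2 := xpredT)) ?filter_predT //.
  rewrite negb_forall => /existsP[i mi]; rewrite mul0r raddf0; apply: X_odd.
  rewrite size_filter -[X in (_ < X)%N](size_enum_ord n) ltn_neqAle count_size.
  by rewrite andbT -all_count; apply/allPn; exists i => //; exact: mem_enum.
rewrite X_desc; apply: IH => [Z g Zh Zd g_unit||].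
- rewrite -(kameko_msubst F_le1) //.
  have := f_inv (Z \o @kameko F n) g; rewrite /=; apply=> //.
    move=> k h k0 /=; rewrite (kameko_tsq F_le1).
    case: ifP => [|ek]; first by rewrite raddf0.
    by apply: Zh; move: k0 ek; case: k => [|[|k]].
  move=> m dm /=; rewrite kamekoX; case: ifP => [/forallP om|_]; last exact: raddf0.
  apply: Zd; apply: contra_neq dm => <-; rewrite mdeg_half addnC; congr (_ + _)%N.
  by rewrite /modds (eq_filter (a2 := xpredT)) ?filter_predT.
- exact: (kills_hits_descend F_le1 Xh X_odd szE).
- move=> m dm; rewrite /Y /= /descend mpolyXn /XE mprodXE -mpolyXD; apply: Xd.
  apply: contra_neq dm; rewrite mdegD mdegMn mdeg_sum muln2.
  rewrite (eq_bigr (fun=> 1%N)) ?sum1_size ?szE => [|i _]; last by rewrite mdeg1.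
  by rewrite addnC => /addIn/double_inj.
Qed.

End InvariantClasses.

(** The lower bound on the number of powers of 2 follows the binary digits. The number [z] of
    summands equal to 1 has the parity of the total; merging ones in pairs and halving leaves a sum
    for [N] with [z./2] ones. *)
Lemma pow2_sum_double N a :
  (forall ks, \sum_(j <- ks) 2 ^ j = N -> a <= size ks)%N ->
  (forall ks, \sum_(j <- ks) 2 ^ j = N.*2 -> a <= size ks)%N /\
  (forall ks, \sum_(j <- ks) 2 ^ j = N.*2.+1 -> a < size ks)%N.
Proof.
move=> Na.
have split ks : exists2 ks', (size ks = count_mem 0%N ks + size ks')%N &
   (\sum_(j <- ks) 2 ^ j = count_mem 0%N ks + (\sum_(j <- ks') 2 ^ j).*2)%N.
  elim: ks => [|[|j] ks [ks' sz sm]]; first by exists [::]; rewrite // !big_nil.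
    by exists ks'; rewrite /= ?big_cons ?sz // sm add1n.
  exists (j :: ks'); rewrite /= ?sz ?addnS // !big_cons sm expnS doubleD.
  by rewrite mul2n addnCA.
have gen ks z : (\sum_(j <- ks) 2 ^ j + z = N -> a <= size ks + z)%N.
  move=> e; have := Na (ks ++ nseq z 0%N); rewrite big_cat /= big_nseq size_cat size_nseq.
  by rewrite iter_addn mul1n addn0; apply.
split=> ks; have [ks' -> ->] := split ks; set z := count _ _ => e.
  have := gen ks' z./2; lia.
have := gen ks' z./2; lia.
Qed.

Lemma F2_le1 (c : 'F_2) : c = 0 \/ c = 1.
Proof. by case: c => [[|[|k]] lt] //; [left|right]; apply: val_inj. Qed.

(** * Coinvariants and invariant classes modulo hits *)

Section Bridge.
Variables (n d : nat).
Local Notation P := {mpoly 'F_2[n]}.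

Section Extend.
Variable x : homology n d.

Definition hom_ext (h : P) : 'F_2 := x (DHomog (pihomogP mdeg d h)).

Fact hom_ext_is_additive : nmod_morphism hom_ext.
Proof.
split=> [|h h'].
  by rewrite -[RHS](linear0 x); congr (x _); apply: val_inj; exact: pihomog0.
rewrite /hom_ext.
transitivity (x ((DHomog (pihomogP mdeg d h) : cohomology n d) +
                 (DHomog (pihomogP mdeg d h') : cohomology n d))).
  by congr (x _); apply: val_inj; exact: pihomogD.
exact: (linearD x).
Qed.

HB.instance Definition _ :=
  Algebra.isNmodMorphism.Build P 'F_2 hom_ext hom_ext_is_additive.

Lemma hom_extE (f : cohomology n d) : hom_ext (val f) = x f.
Proof. by congr (x _); apply: val_inj; exact: pihomog_dE (valP f). Qed.

Lemma hom_ext_concentrated : concentrated d hom_ext.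
Proof.
move=> m dm; rewrite /hom_ext -[RHS](linear0 x); congr (x _); apply: val_inj.
by rewrite /= pihomogX (negbTE dm).
Qed.

Lemma hom_ext_kills_hits : x \in PA n d -> kills_hits 1%g hom_ext.
Proof.
move=> /memPA xP k h k0; rewrite -total_sq_tsq -/(Sq k h).
elim/(@mpoly_ind01 'F_2 n F2_le1): h => [|h h' IH IH'|m].
- by rewrite !raddf0.
- have -> : Sq k (h + h') = Sq k h + Sq k h' by exact: linearD.
  exact (etrans (raddfD hom_ext _ _) (etrans (congr2 +%R IH IH') (addr0 0))).
have [ekd|nkd] := eqVneq (mdeg m + k)%N d.
  have Xm : ('X_[m] : P) \is (mdeg m).-homog by rewrite dhomogX.
  exact: etrans (hom_extE (coh_Sq_fun ekd (DHomog Xm))) (xP k _ ekd _ k0).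
rewrite /hom_ext -[RHS](linear0 x); congr (x _); apply: val_inj => /=.
apply: pihomog_ne0 nkd _; apply: Sq_homog (erefl _) _; by rewrite dhomogX.
Qed.

End Extend.

Section Restrict.
Variable X : {additive P -> 'F_2}.

Definition hom_restrict_fun (f : cohomology n d) : ('F_2)^o := X (val f).

Fact hom_restrict_is_linear : linear hom_restrict_fun.
Proof.
move=> c f f'; rewrite /hom_restrict_fun.
have -> : val (c *: f + f') = c *: val f + val f' by exact: linearP.
apply: etrans (raddfD X _ _) _; congr (_ + _).
by case: (F2_le1 c) => ->; rewrite ?scale0r ?raddf0 // !scale1r.
Qed.

HB.instance Definition _ :=
  GRing.isLinear.Build 'F_2 (cohomology n d) (('F_2)^o) _ hom_restrict_fun
    hom_restrict_is_linear.

Definition hom_restrict : homology n d := linfun hom_restrict_fun.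

Lemma hom_restrictE f : hom_restrict f = X (val f).
Proof. by rewrite lfunE. Qed.

Lemma hom_restrict_PA : kills_hits 1%g X -> hom_restrict \in PA n d.
Proof.
move=> Xh; apply/memPA => k e ekd f k0; rewrite hom_restrictE /= /Sq.
by have := Xh k (val f) k0; rewrite -total_sq_tsq.
Qed.

End Restrict.

Lemma linear_form_separation (V : vectType 'F_2) (W : {vspace V}) (v : V) :
  v \notin W -> exists phi : 'Hom(V, ('F_2)^o), phi v != 0 /\ forall w, w \in W -> phi w = 0.
Proof.
move=> vW; pose z := v - projv W v.
have z0 : z != 0.
  by apply: contraNneq vW => /eqP; rewrite subr_eq0 => /eqP ->; exact: memv_proj.
have [i zi] : exists i, coord (vbasis {:V}) i z != 0.
  apply/existsP; apply: contraNT z0 => /existsPn zi.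
  rewrite (coord_vbasis (memvf z)); apply/eqP/big1 => i _.
  by have := zi i; rewrite negbK => /eqP ->; rewrite scale0r.
pose phi := (linfun (coord (vbasis {:V}) i : V -> ('F_2)^o) \o (\1 - projv W))%VF.
exists phi; split=> [|w wW].
  by rewrite /phi comp_lfunE lfunE /= !lfunE /= opp_lfunE id_lfunE.
rewrite /phi comp_lfunE lfunE /= add_lfunE opp_lfunE id_lfunE projv_id //.
by rewrite subrr linear0.
Qed.

(** Finite-dimensional biduality; the [c i] form the basis dual to [e]. *)
Lemma hom_double_dual (phi : 'Hom(homology n d, ('F_2)^o)) :
  exists f : cohomology n d, forall x, phi x = x f.
Proof.
pose e := vbasis {:cohomology n d}.
pose c i : homology n d := linfun (coord e i : cohomology n d -> ('F_2)^o).
exists (\sum_(i < \dim {:cohomology n d}) phi (c i) *: e`_i) => x.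
have {1}-> : x = \sum_(i < \dim {:cohomology n d}) x e`_i *: c i.
  apply/lfunP => f; rewrite {1}(coord_vbasis (memvf f)) linear_sum sum_lfunE.
  by apply: eq_bigr => i _; rewrite linearZ scale_lfunE lfunE /= [RHS]mulrC.
rewrite !linear_sum; apply: eq_bigr => i _.
by rewrite !linearZ /= [LHS]mulrC.
Qed.

(** A class outside the relations would be detected by a functional vanishing on them. That
    functional is evaluation at some [f]; vanishing on the relations says that [f] is an invariant
    class, so it detects nothing. *)
Lemma coinvariants_eq0 :
  no_invariant_class 'F_2 n d -> forall x : GL_coinvariants (PA_act n d), x = 0.
Proof.
move=> Hinv x; elim/quotW: x => y.
suff yW : y \in GL_relations (PA_act n d).
  have : y - 0 \in GL_relations (PA_act n d) by rewrite subr0.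
  by rewrite Quotient.idealrBE => /eqP ->; rewrite raddf0.
apply/negPn/negP => /linear_form_separation[phi [phiy phiW]]; case/negP: phiy.
(* Composition with the projection onto [PA n d] extends [phi] to all of [homology n d], where
   biduality applies. *)
have [f fE] := hom_double_dual (phi \o linfun (vsproj (PA n d)))%VF.
have phiE (z : subvs_of (PA n d)) : phi z = vsval z f.
  by rewrite -fE comp_lfunE lfunE /= vsvalK.
rewrite phiE -hom_extE.
apply/eqP/(Hinv (val f)); [|exact: hom_ext_kills_hits (subvsP y)|exact: hom_ext_concentrated].
move=> X g Xh Xd g_unit.
pose z := Subvs (hom_restrict_PA Xh).
have := phiW ((PA_act n d g - \1)%VF z).
have -> : (PA_act n d g - \1)%VF z \in GL_relations (PA_act n d).
  apply: subv_trans (sumv_sup g g_unit (subvv _)); exact: memv_img (memvf z).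
move=> /(_ isT); rewrite add_lfunE opp_lfunE id_lfunE linearB => /eqP.
rewrite subr_eq0 /= !phiE => /eqP; rewrite lfunE /= hom_actE !hom_restrictE.
by [].
Qed.

End Bridge.

(** * Coordinates over an extension field *)

Section MooreCoordinates.
Variables (F : comUnitRingType) (A : comNzRingType) (io : {rmorphism F -> A}).
Variable n : nat.
Hypothesis F_le1 : forall c : F, c = 0 \/ c = 1.
Hypothesis frobA : forall a : A, a ^+ (2 ^ n) = a.
Local Notation P := {mpoly F[n]}.
Local Notation PA := {mpoly A[n]}.
Local Notation N := (2 ^ n - 1)%N.
Implicit Types (q : 'I_n -> A) (h f : P) (H : PA) (m : 'X_{1..n}).

Lemma pchar_A2 : 2%N \in [pchar A].
Proof.
rewrite inE /= -(rmorph_nat io); case: (F_le1 2%:R) => [->|/eqP]; first by rewrite rmorph0.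
by rewrite -subr_eq0 (natrD _ 1 1) addrK oner_eq0.
Qed.

Lemma io_sqr c : io c ^+ 2 = io c.
Proof. by case: (F_le1 c) => ->; rewrite ?rmorph0 ?rmorph1 ?expr0n ?expr1n. Qed.

Lemma io_pow2 c k : io c ^+ (2 ^ k) = io c.
Proof. by elim: k => [|k IH]; rewrite ?expr1 // expnS exprM io_sqr. Qed.

Definition shift_perm : {perm 'I_n} := perm (@ord_pred_inj n).

Definition moore q : 'M[A]_n := \matrix_(j, l) q l ^+ (2 ^ j).

(** The rows are indexed cyclically: passing from the last row to row 0 uses [frobA]. *)
Lemma moore_pred q (j l : 'I_n) : moore q (ord_pred j) l ^+ 2 = moore q j l.
Proof.
rewrite !mxE -exprM -expnSr /=.
have := ltn_ord j; case: {j}(nat_of_ord j) => [|j] lt_jn.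
  by rewrite add0n modn_small ?prednK // frobA expr1.
by rewrite addSn /= modnDr modn_small ?(ltnW lt_jn).
Qed.

Lemma moore_ordS q (j l : 'I_n) : moore (fun i => q i ^+ 2) j l = moore q (ordS j) l.
Proof. by rewrite -(moore_pred q (ordS j)) ordSK !mxE -!exprM mulnC. Qed.

(** In the source, ['X_j] stands for the form v_j; [theta] rewrites a polynomial in the v_j in the
    variables u_l. *)
Definition theta q : P -> PA := msubst (moore q) \o map_mpoly io.

HB.instance Definition _ q := GRing.RMorphism.on (theta q).

Lemma thetaXU q j : theta q 'X_j = \sum_l moore q j l *: 'X_l.
Proof. by rewrite /theta /= map_mpolyX msubstXU. Qed.

Lemma thetaC q c : theta q c%:MP = (io c)%:MP.
Proof. by rewrite /theta /= map_mpolyC /msubst comp_mpolyC. Qed.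

Lemma theta_sqr q j : theta q ('X_(ord_pred j) ^+ 2) = \sum_l moore q j l *: 'X_l ^+ 2.
Proof.
have c2 : 2%N \in [pchar PA] by rewrite (rmorph_pchar (@mpolyC n A)) // pchar_A2.
rewrite rmorphXn /= thetaXU (sqr_sum_char2 c2); apply: eq_bigr => l _.
by rewrite exprZn moore_pred.
Qed.

(** It suffices to compare on variables, where this is Sq v_j = v_j + v_(j-1)^2: the coefficients of
    v_j are the squares of those of v_(j-1). *)
Lemma tsq_theta q h : tsq 1%g (theta q h) = map_poly (theta q) (tsq shift_perm h).
Proof.
pose f1 : {rmorphism P -> {poly PA}} := tsq 1%g \o theta q.
pose f2 : {rmorphism P -> {poly PA}} := map_poly (theta q) \o tsq shift_perm.
suff : f1 =1 f2 by apply.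
apply: mpoly_rmorph_ext => [c|j] /=.
  by rewrite thetaC !tsqC map_polyC /= thetaC.
rewrite tsqXU rmorphD rmorphM /= !map_polyC map_polyX /= permE theta_sqr thetaXU.
rewrite !rmorph_sum mulr_suml -big_split /=; apply: eq_bigr => l _.
by rewrite -!mul_mpolyC rmorphM /= tsqC tsqXU perm1 !polyCM mulrDr !mulrA.
Qed.

Section ScalarExtension.
Variable X : {additive P -> F}.

Definition xhat : PA -> A := mlin (fun m => io (X 'X_[m]) : A^o).

HB.instance Definition _ := GRing.Linear.copy xhat (mlin (fun m => io (X 'X_[m]) : A^o)).

Lemma xhatX m : xhat 'X_[m] = io (X 'X_[m]).
Proof. exact: (@mlinX A n (A^o) (fun m => io (X 'X_[m]))). Qed.

Lemma xhat_map h : xhat (map_mpoly io h) = io (X h).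
Proof.
elim/(@mpoly_ind01 F n F_le1): h => [|h h' IH IH'|m].
- by rewrite !raddf0.
- by rewrite !raddfD /= IH IH'.
by rewrite map_mpolyX xhatX.
Qed.

Lemma tsq_map_mpoly h : tsq 1%g (map_mpoly io h) = map_poly (map_mpoly io) (tsq 1%g h).
Proof.
pose f1 : {rmorphism P -> {poly PA}} := tsq 1%g \o map_mpoly io.
pose f2 : {rmorphism P -> {poly PA}} := map_poly (map_mpoly io) \o tsq 1%g.
suff : f1 =1 f2 by apply.
apply: mpoly_rmorph_ext => [c|j] /=.
  by rewrite map_mpolyC !tsqC map_polyC /= map_mpolyC.
rewrite !tsqXU [RHS]rmorphD [in RHS]rmorphM /= !map_polyC map_polyX /=.
by rewrite rmorphXn /= !map_mpolyX tsqXU.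
Qed.

Lemma xhat_kills_hits k H :
  kills_hits 1%g X -> (0 < k)%N -> xhat (tsq 1%g H)`_k = 0.
Proof.
move=> Xh k0; elim/mpolyind: H => [|c m H _ _ IH].
  by rewrite rmorph0 coef0 raddf0.
have e : (tsq 1%g ('X_[m] : PA))`_k = map_mpoly io (tsq 1%g 'X_[m])`_k.
  by have := tsq_map_mpoly 'X_[m]; rewrite map_mpolyX => ->; rewrite coef_map.
have eZ : xhat (tsq 1%g (c *: 'X_[m]))`_k = 0.
  have -> := coef_tsqZ 1%g k c ('X_[m] : PA).
  by rewrite e linearZ /= xhat_map Xh // rmorph0 scaler0.
have -> := coef_tsqD 1%g k (c *: 'X_[m]) H.
exact: (etrans (raddfD xhat _ _) (etrans (congr2 +%R eZ IH) (addr0 0))).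
Qed.

Lemma xhat_homog d e H :
  concentrated d X -> H \is e.-homog -> e != d -> xhat H = 0.
Proof.
move=> Xd /dhomogP He ne; rewrite /xhat /mlin big_seq big1 // => m mH.
by rewrite Xd ?(He m mH) // rmorph0 scaler0.
Qed.

Definition lam q : P -> A := xhat \o theta q.

HB.instance Definition _ q := Algebra.Additive.on (lam q).

Lemma lam_kills_hits q : kills_hits 1%g X -> kills_hits shift_perm (lam q).
Proof.
move=> Xh k h k0; rewrite /lam /=.
have := xhat_kills_hits (theta q h) Xh k0.
by rewrite tsq_theta coef_map.
Qed.

Lemma theta_homog q m : theta q 'X_[m] \is (mdeg m).-homog.
Proof.
rewrite mpolyXE_id rmorph_prod mdegE.
apply: (big_ind2 (fun e (p : PA) => p \is e.-homog)) => [|a p b r|i _].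
- exact: dhomog1.
- exact: dhomogM.
have lin1 : theta q 'X_i \is 1.-homog.
  rewrite thetaXU; apply: rpred_sum => j _; apply: rpredZ.
  by rewrite dhomogX /= mdeg1.
by rewrite rmorphXn; have := dhomogMn (m i) lin1; rewrite mul1n.
Qed.

Lemma lam_concentrated d q : concentrated d X -> concentrated d (lam q).
Proof. by move=> Xd m dm; exact: xhat_homog Xd (theta_homog q m) dm. Qed.

Definition wt m : nat := \sum_(j < n) m j * 2 ^ j.
Definition mrot m : 'X_{1..n} := [multinom m (ord_pred j) | j < n].

(** Scaling the basis by [c] scales v_j by [c ^+ (2 ^ j)]. *)
Lemma lamZ q c m : lam (fun l => c * q l) 'X_[m] = c ^+ wt m * lam q 'X_[m].
Proof.
rewrite /lam /=.
have -> : theta (fun l => c * q l) 'X_[m] = c ^+ wt m *: theta q 'X_[m].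
  rewrite mpolyXE_id !rmorph_prod /= /wt -prodrXr -scaler_prod.
  apply: eq_bigr => j _; rewrite !rmorphXn /= mulnC exprM -exprZn !thetaXU.
  congr (_ ^+ _); rewrite scaler_sumr; apply: eq_bigr => l _.
  by rewrite scalerA !mxE exprMn.
by rewrite linearZ.
Qed.

(** Squaring the basis replaces each v_j by v_(j+1), with cyclic indices. *)
Lemma lam_sqr_mrot q m : lam (fun l => q l ^+ 2) 'X_[m] = lam q 'X_[mrot m].
Proof.
congr xhat; rewrite !mpolyXE_id !rmorph_prod /=.
rewrite [RHS](reindex_inj (@ordS_inj n)); apply: eq_bigr => j _.
rewrite mnmE ordSK !rmorphXn /= !thetaXU; congr (_ ^+ _).
by apply: eq_bigr => l _; rewrite moore_ordS.
Qed.

(** [X] takes values in [F], which Frobenius fixes, so [xhat] commutes with Frobenius on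
    coefficients. *)
Lemma lam_sqr q m : lam (fun l => q l ^+ 2) 'X_[m] = lam q 'X_[m] ^+ 2.
Proof.
pose fr : {rmorphism A -> A} := pFrobenius_aut pchar_A2.
rewrite /lam /=.
have -> : theta (fun l => q l ^+ 2) 'X_[m] = map_mpoly fr (theta q 'X_[m]).
  pose f1 : {rmorphism P -> PA} := theta (fun l => q l ^+ 2).
  pose f2 : {rmorphism P -> PA} := map_mpoly fr \o theta q.
  suff : f1 =1 f2 by apply.
  apply: mpoly_rmorph_ext => [c|j] /=.
    by rewrite !thetaC map_mpolyC /= /fr pFrobenius_autE io_sqr.
  rewrite !thetaXU rmorph_sum; apply: eq_bigr => l _ /=.
  by rewrite map_mpolyZ map_mpolyX /= pFrobenius_autE !mxE -!exprM mulnC.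
elim/mpolyind: (theta q _) => [|c m' H _ _ IH].
  by rewrite rmorph0 !raddf0 expr0n.
rewrite rmorphD !raddfD /= IH map_mpolyZ map_mpolyX !linearZ /= !xhatX.
by rewrite (sqrD_char2 pchar_A2) pFrobenius_autE ?mulr_regl exprMn io_sqr.
Qed.

End ScalarExtension.

End MooreCoordinates.

(** * Averaging over the normalizer of a Singer cycle *)

Section SingerAverage.
Variables (F : comUnitRingType) (A : comNzRingType) (io : {rmorphism F -> A}).
Variable n : nat.
Hypothesis F_le1 : forall c : F, c = 0 \/ c = 1.
Hypothesis frobA : forall a : A, a ^+ (2 ^ n) = a.
Local Notation P := {mpoly F[n]}.
Local Notation PA := {mpoly A[n]}.
Local Notation N := (2 ^ n - 1)%N.
Implicit Types (q : 'I_n -> A) (h f : P) (H : PA) (m : 'X_{1..n}).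

Variables (z : A) (p p' : 'I_n -> A).
Hypotheses (n_odd : odd n) (z_order : z ^+ N = 1).
Hypothesis z_sum : forall w, ~~ (N %| w)%N -> \sum_(k < N) z ^+ (k * w) = 0.

(* The sum over [j] is the trace form of F_(2^n) over F_2. *)
Definition dual_bases q q' :=
  forall l l' : 'I_n, \sum_(j < n) (q' l * q l') ^+ (2 ^ j) = (l == l')%:R.

Hypothesis pp' : dual_bases p p'.
Hypothesis p_span : forall a : A, exists c : 'I_n -> F, a = \sum_i p i * io (c i).

Let c2 : 2%N \in [pchar A] := pchar_A2 io F_le1.

Lemma dual_bases_moore q q' : dual_bases q q' ->
  (\matrix_(l, j) q' l ^+ (2 ^ j)) *m moore q = 1%:M.
Proof.
move=> qq'; apply/matrixP => l l'; rewrite !mxE -qq'; apply: eq_bigr => j _.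
by rewrite !mxE exprMn.
Qed.

(** The exponent [N - k %% N] expresses the inverse of [z ^+ k] as a natural power. *)
Lemma dual_basesZ q q' k : dual_bases q q' ->
  dual_bases (fun l => z ^+ k * q l) (fun l => z ^+ (N - k %% N) * q' l).
Proof.
move=> qq' l l'; rewrite -qq'; apply: eq_bigr => j _; congr (_ ^+ _).
rewrite mulrACA -exprD.
suff -> : z ^+ (N - k %% N + k) = 1 by rewrite mul1r.
have N0 : (0 < N)%N by rewrite subn_gt0 -(expn0 2) ltn_exp2l // odd_gt0.
have -> : (N - k %% N + k = N * (k %/ N).+1)%N.
  have := ltn_pmod k N0; rewrite {3}(divn_eq k N) mulnS [(N * _)%N]mulnC.
  by move: (k %/ N * N)%N (k %% N)%N => Q r; lia.
by rewrite exprM z_order expr1n.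
Qed.

Lemma dual_bases_sqr q q' : dual_bases q q' ->
  dual_bases (fun l => q l ^+ 2) (fun l => q' l ^+ 2).
Proof.
move=> qq' l l'; have := congr1 (fun a => a ^+ 2) (qq' l l').
rewrite (sqr_sum_char2 c2) -natrX expnE /= => e.
have {e} -> : (l == l')%:R = (l == l')%:R ^+ 2 :> A.
  by case: (l == l'); rewrite ?expr1n ?expr0n.
rewrite -qq' (sqr_sum_char2 c2); apply: eq_bigr => j _.
by rewrite -exprMn -!exprM mulnC.
Qed.

(** Powers of Frobenius followed by multiplication by powers of [z]: these maps make up the
    normalizer of the Singer cycle generated by [z]. *)
Definition singer_conj q (i k : nat) : 'I_n -> A := fun l => z ^+ k * q l ^+ (2 ^ i).

Lemma dual_bases_conj q q' i k : dual_bases q q' ->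
  exists r', dual_bases (singer_conj q i k) r'.
Proof.
move=> qq'.
have [r' qr'] : exists r', dual_bases (fun l => q l ^+ (2 ^ i)) r'.
  elim: i => [|i [r' IH]]; first by exists q' => l l'; rewrite -qq' expr1.
  exists (fun l => r' l ^+ 2) => l l'.
  by rewrite -(dual_bases_sqr IH); apply: eq_bigr => j _; rewrite expnSr exprM.
by exists (fun l => z ^+ (N - k %% N) * r' l); exact: dual_basesZ.
Qed.

(** [g] holds the coordinates of [q] with respect to [p]. Frobenius fixes its entries, so one matrix
    serves all rows. The dual basis makes [moore q] invertible, which excludes [\det g = 0]. *)
Lemma dual_bases_change q q' : dual_bases q q' ->
  exists2 g : 'M[F]_n, g \in unitmx & moore q = moore p *m map_mx io g.
Proof.
move=> qq'.
have [g gE] : exists g : 'M[F]_n, forall l, q l = \sum_i p i * io (g i l).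
  have /fin_all_exists[c cE] : forall l, exists c : 'I_n -> F, q l = \sum_i p i * io (c i).
    by move=> l; exact: p_span.
  by exists (\matrix_(i, l) c l i) => l; rewrite cE; apply: eq_bigr => i _; rewrite mxE.
have e : moore q = moore p *m map_mx io g.
  apply/matrixP => j l; rewrite !mxE gE.
  have -> : (\sum_i p i * io (g i l)) ^+ (2 ^ j) =
            \sum_i (p i * io (g i l)) ^+ (2 ^ j).
    elim: (j : nat) => [|k IH]; first by apply: eq_bigr => i _; rewrite expr1.
    rewrite expnSr exprM IH (sqr_sum_char2 c2); apply: eq_bigr => i _.
    by rewrite -exprM.
  by apply: eq_bigr => i _; rewrite !mxE exprMn (io_pow2 io F_le1).
exists g => //; rewrite unitmxE.
case: (F_le1 (\det g)) => [g0|->]; last exact: unitr1.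
have := congr1 determinant (dual_bases_moore qq'); rewrite e.
rewrite !det_mulmx det_map_mx g0 rmorph0 !mulr0 det1 => /eqP.
by rewrite eq_sym oner_eq0.
Qed.

Section Functional.
Variable X : {additive P -> F}.

(** The number [n * N] of terms is odd, so in characteristic 2 this sum is already an average. *)
Definition average q (h : P) : A := \sum_(i < n) \sum_(k < N) lam io X (singer_conj q i k) h.

Fact average_is_additive q : nmod_morphism (average q).
Proof.
split=> [|h h']; rewrite /average.
  by rewrite big1 // => i _; rewrite big1 // => k _; rewrite raddf0.
rewrite -big_split; apply: eq_bigr => i _; rewrite -big_split.
by apply: eq_bigr => k _; rewrite raddfD.
Qed.

HB.instance Definition _ q :=
  Algebra.isNmodMorphism.Build P A (average q) (average_is_additive q).

Lemma average_kills_hits q : kills_hits 1%g X -> kills_hits (shift_perm n) (average q).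
Proof.
move=> Xh k h k0; rewrite /average big1 // => i _; rewrite big1 // => l _.
exact: (lam_kills_hits io F_le1 frobA (singer_conj q i l) Xh h k0).
Qed.

Lemma average_concentrated d q : concentrated d X -> concentrated d (average q).
Proof.
move=> Xd m dm; rewrite /average big1 // => i _; rewrite big1 // => l _.
exact: (lam_concentrated io (singer_conj q i l) Xd dm).
Qed.

Lemma natr_odd k : odd k -> k%:R = 1 :> A.
Proof.
move=> ok; rewrite -(odd_double_half k) ok natrD -muln2 natrM.
by rewrite (pcharf0 c2) mulr0 addr0.
Qed.

Lemma N_odd : odd N.
Proof.
case: n n_odd => // k _; rewrite expnS mul2n oddB ?odd_double //.
by rewrite -mul2n -expnS expn_gt0.
Qed.

(** The sum over [k] is a sum of powers of [z ^+ wt m]: it is 0 unless [N] divides the weight, and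
    otherwise [N], which is 1 in [A]. *)
Lemma averageX q m :
  average q 'X_[m] =
    if (N %| wt m)%N then \sum_(i < n) lam io X (fun l => q l ^+ (2 ^ i)) 'X_[m] else 0.
Proof.
rewrite /average; under eq_bigr => i _ do under eq_bigr => k _ do rewrite lamZ -exprM.
under eq_bigr => i _ do rewrite -mulr_suml.
case: ifP => [/dvdnP[w wE]|/negbT Nw]; last first.
  by rewrite big1 // => i _; rewrite z_sum ?mul0r.
apply: eq_bigr => i _; rewrite (eq_bigr (fun=> 1)) => [|k _].
  by rewrite sumr_const card_ord (natr_odd N_odd) mul1r.
by rewrite wE mulnA mulnC exprM z_order expr1n.
Qed.

Lemma eq_lam q q1 h : q =1 q1 -> lam io X q h = lam io X q1 h.
Proof.
move=> qq; have mE : moore q = moore q1 by apply/matrixP => j l; rewrite !mxE qq.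
by rewrite /lam /theta mE.
Qed.

Lemma lam_pow2 q i m :
  lam io X (fun l => q l ^+ (2 ^ i)) 'X_[m] = lam io X q 'X_[m] ^+ (2 ^ i).
Proof.
elim: i => [|i IH]; first by rewrite expr1; apply: eq_lam => l; rewrite expr1.
rewrite expnSr exprM -IH -(lam_sqr io F_le1); apply: eq_lam => l.
by rewrite -exprM.
Qed.

Lemma average_trace q m : (N %| wt m)%N ->
  average q 'X_[m] = \sum_(i < n) lam io X q 'X_[m] ^+ (2 ^ i).
Proof.
by move=> Nm; rewrite averageX Nm; apply: eq_bigr => i _; rewrite lam_pow2.
Qed.

(** Rotation doubles the weight modulo [N], because 2^n is 1 modulo [N], and 2 is prime to [N]. *)
Lemma dvdn_wt_mrot m : (N %| wt (mrot m))%N = (N %| wt m)%N.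
Proof.
have [k kE] : exists k, (2 * wt m = wt (mrot m) + k * N)%N.
  have j2 (j : 'I_n) : exists k, (2 * (m j * 2 ^ j) = m j * 2 ^ ordS j + k * N)%N.
    have := ltn_ord j; rewrite leq_eqVlt => /orP[/eqP jn|jn].
      exists (m j); rewrite /= jn modnn -mulnDr mulnCA -expnS jn.
      by rewrite subnKC // expn_gt0.
    by exists 0%N; rewrite /= modn_small // mul0n addn0 mulnCA -expnS.
  have /fin_all_exists[k kE] := j2; exists (\sum_j k j)%N.
  rewrite /wt big_distrr [X in (X + _)%N](reindex_inj (@ordS_inj n)) big_distrl.
  rewrite -big_split; apply: eq_bigr => j _ /=.
  by rewrite mnmE ordSK kE.
have cop : coprime N 2 by rewrite coprimen2 N_odd.
by rewrite -(Gauss_dvdr (wt m) cop) kE dvdn_addl // dvdn_mull.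
Qed.

Lemma average_mrot q m : average q 'X_[mrot m] = average q 'X_[m].
Proof.
rewrite [LHS]averageX [RHS]averageX (dvdn_wt_mrot m).
case: (boolP (N %| wt m)%N) => [_|//].
rewrite [LHS](reindex_inj (@ord_pred_inj n)); apply: eq_bigr => i _.
rewrite -(lam_sqr_mrot io frobA); apply: eq_lam => l.
rewrite -exprM -expnSr /=.
have := ltn_ord i; case: {i}(nat_of_ord i) => [|i] lt_in.
  by rewrite add0n modn_small ?prednK // frobA expr1.
by rewrite addSn /= modnDr modn_small ?(ltnW lt_in).
Qed.

End Functional.

Lemma map_msubst (g : 'M[F]_n) f :
  map_mpoly io (msubst g f) = msubst (map_mx io g) (map_mpoly io f).
Proof.
pose f1 : {rmorphism P -> PA} := map_mpoly io \o msubst g.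
pose f2 : {rmorphism P -> PA} := msubst (map_mx io g) \o map_mpoly io.
suff : f1 =1 f2 by apply.
apply: mpoly_rmorph_ext => [c|j] /=.
  by rewrite /msubst comp_mpolyC !map_mpolyC comp_mpolyC.
rewrite map_mpolyX !msubstXU rmorph_sum; apply: eq_bigr => l _ /=.
by rewrite map_mpolyZ map_mpolyX mxE.
Qed.

(** [H] is [f] written in the forms v_j of the basis [p]. Another basis amounts to a substitution
    from GL_n, which does not change the value of [X], so the same coefficients serve every [q]. *)
Lemma invariant_expansion d f : invariant_class d f ->
  exists H, forall (X : {additive P -> F}) q q', kills_hits 1%g X -> concentrated d X ->
    dual_bases q q' ->
    io (X f) = \sum_(m <- msupp H) H@_m * average X q 'X_[m].
Proof.
move=> f_inv; pose W := \matrix_(l, j) p' l ^+ (2 ^ j) : 'M[A]_n.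
pose H := msubst W (map_mpoly io f); exists H => X q q' Xh Xd qq'.
have key r r' : dual_bases r r' ->
    io (X f) = \sum_(m <- msupp H) H@_m * lam io X r 'X_[m].
  move=> rr'; have [g g_unit rE] := dual_bases_change rr'.
  have He : msubst (moore r) H = map_mpoly io (msubst g f).
    rewrite rE msubstM /H -[msubst (moore p) _]msubstM (dual_bases_moore pp') msubst1.
    exact/esym/map_msubst.
  rewrite -(f_inv X g Xh Xd g_unit) -(xhat_map io F_le1) -He.
  rewrite [in LHS](mpolyE H) [msubst _ _]raddf_sum [LHS]raddf_sum.
  apply: eq_bigr => m _; rewrite /lam /theta /= map_mpolyX.
  by rewrite [msubst _ _]linearZ [LHS]linearZ.
(* All [n * N] conjugates of [q] give the same value, and their number is odd. *)
have -> : io (X f) = \sum_(i < n) \sum_(k < N) io (X f).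
  rewrite (eq_bigr (fun=> io (X f))) => [|i _].
    by rewrite sumr_const card_ord -mulr_natl (natr_odd n_odd) mul1r.
  by rewrite sumr_const card_ord -mulr_natl (natr_odd N_odd) mul1r.
rewrite /average; under [RHS]eq_bigr => m _ do rewrite mulr_sumr.
rewrite [RHS]exchange_big; apply: eq_bigr => i _.
under [RHS]eq_bigr => m _ do rewrite mulr_sumr.
rewrite [RHS]exchange_big; apply: eq_bigr => k _.
by have [r' rr'] := dual_bases_conj i k qq'; exact: key rr'.
Qed.

End SingerAverage.

(** * The field with 32 elements *)

(* [C32 a b c d e] is a + b z + c z^2 + d z^3 + e z^4, where z^5 = z^2 + 1. *)
Inductive F32 := C32 of bool & bool & bool & bool & bool.

Module F32.

Definition code x := let: C32 a b c d e := x in (a, b, c, d, e).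
Definition decode x := let: (a, b, c, d, e) := x in C32 a b c d e.
Lemma codeK : cancel code decode. Proof. by case. Qed.

Definition zero := C32 false false false false false.
Definition one := C32 true false false false false.
Definition add x y :=
  let: C32 a b c d e := x in let: C32 a' b' c' d' e' := y in
  C32 (addb a a') (addb b b') (addb c c') (addb d d') (addb e e').
Definition mulz x := let: C32 a b c d e := x in C32 e a (addb b e) c d.
Definition mul x y :=
  let: C32 a b c d e := x in
  let step (s : bool) t := if s then add y (mulz t) else mulz t in
  step a (step b (step c (step d (step e zero)))).

End F32.

HB.instance Definition _ := Equality.copy F32 (can_type F32.codeK).
HB.instance Definition _ := Choice.copy F32 (can_type F32.codeK).

Module F32Ring.
Import F32.

Definition elements :=
  let B := [:: false; true] in
  [seq f e | f <- [seq f d | f <- [seq f c | f <- [seq C32 a b | a <- B, b <- B],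
    c <- B], d <- B], e <- B].

Definition all32 (P : F32 -> bool) := all P elements.

Lemma all32P P : all32 P -> forall x, P x.
Proof. by move=> /allP allP x; apply: allP; case: x => [[] [] [] [] []]; vm_compute. Qed.

Definition eqf x y :=
  let: C32 a b c d e := x in let: C32 a' b' c' d' e' := y in
  [&& a == a', b == b', c == c', d == d' & e == e'].

Lemma eqfP x y : eqf x y -> x = y.
Proof. by case: x y => [a b c d e] [a' b' c' d' e'] /and5P[/eqP-> /eqP-> /eqP-> /eqP-> /eqP->]. Qed.

Fact addA : associative add.
Proof. by move=> [a b c d e] [? ? ? ? ?] [? ? ? ? ?]; rewrite /= !addbA. Qed.

Fact addC : commutative add.
Proof. by move=> [a b c d e] [? ? ? ? ?] /=; congr C32; exact: addbC. Qed.

Fact add0 : left_id zero add.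
Proof. by case. Qed.

Fact addN : left_inverse zero id add.
Proof. by case=> a b c d e /=; rewrite !addbb. Qed.

Fact mulA : associative mul.
Proof.
move=> x y t; apply: eqfP; move: t; apply: all32P; move: y; apply: all32P.
by move: x; apply: all32P; vm_compute.
Qed.

Fact mulC : commutative mul.
Proof.
move=> x y; apply: eqfP; move: y; apply: all32P; move: x; apply: all32P.
by vm_compute.
Qed.

Fact mul1 : left_id one mul.
Proof. by move=> x; apply: eqfP; move: x; apply: all32P; vm_compute. Qed.

Fact mulD : left_distributive mul add.
Proof.
move=> x y t; apply: eqfP; move: t; apply: all32P; move: y; apply: all32P.
by move: x; apply: all32P; vm_compute.
Qed.

Fact one_neq0 : one != zero. Proof. by []. Qed.

End F32Ring.

HB.instance Definition _ := GRing.isZmodule.Build F32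
  F32Ring.addA F32Ring.addC F32Ring.add0 F32Ring.addN.
HB.instance Definition _ := GRing.Zmodule_isComNzRing.Build F32
  F32Ring.mulA F32Ring.mulC F32Ring.mul1 F32Ring.mulD F32Ring.one_neq0.

(** * Certificates for the hit equations in degree 50 *)

Local Open Scope nat_scope.

(* The [i <= a] with ['C(a, i)] odd, if [a <= fuel]. *)
Fixpoint odd_bins (fuel a : nat) : seq nat :=
  if fuel is fuel'.+1 then
    if a == 0 then [:: 0] else
    let r := odd_bins fuel' a./2 in
    [seq i.*2 | i <- r] ++ (if odd a then [seq i.*2.+1 | i <- r] else [::])
  else [:: 0].

Definition vadd (u v : seq nat) : seq nat := [seq x.1 + x.2 | x <- zip u v].

(* The exponents of v_j ^ x * v_(sh j) ^ y. *)
Definition vterm n (sh : nat -> nat) j x y : seq nat :=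
  mkseq (fun l => (if l == j then x else 0) + (if l == sh j then y else 0)) n.

Fixpoint sq_terms n sh k (js : seq (nat * nat)) : seq (seq nat) :=
  if js is (j, a) :: js' then
    flatten [seq [seq vadd (vterm n sh j (a - i) i.*2) v | v <- sq_terms n sh (k - i) js']
            | i <- odd_bins a a & i <= k]
  else if k == 0 then [:: nseq n 0] else [::].

(* The exponents of Sq^k v^a, with repetitions. *)
Definition sq_list sh k a := sq_terms (size a) sh k (zip (iota 0 (size a)) a).

(* The counts of exponents having binary digit 1 in position 0, 1, 2, ... form a
   sequence lexicographically less than [rs]; for suitable [rs] the chi-trick makes
   such monomials hit. *)
Fixpoint low (rs : seq nat) (a : seq nat) : bool :=
  if rs is r :: rs' then
    let k := count odd a in (k < r) || (k == r) && low rs' (map half a)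
  else false.

Fixpoint lexle (u v : seq nat) : bool :=
  match u, v with
  | x :: u', y :: v' => (x < y) || (x == y) && lexle u' v'
  | _, _ => true
  end.

(** The lexicographically least rotation, a canonical representative of the shift-orbit. *)
Definition rot_min (a : seq nat) : seq nat :=
  foldl (fun m i => let b := rot i a in if lexle b m then b else m) a (iota 1 (size a).-1).

Fixpoint lookup (t : seq nat) (tbl : seq (seq nat * seq bool)) : option (seq bool) :=
  if tbl is (u, r) :: tbl' then if u == t then Some r else lookup t tbl' else None.

Definition xorv (u v : seq bool) : seq bool := [seq x.1 (+) x.2 | x <- zip u v].

(* The table stores orbits as combinations of [b] free ones. A hit equation in
   which one orbit, of odd multiplicity, is missing from the table determines it. *)
Definition hit_step sh rs b tbl (s : nat * seq nat) :=
  let ts := [seq rot_min t | t <- sq_list sh s.1 s.2 & ~~ low rs t] in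
  let r := foldr (fun t r => if lookup t tbl is Some r' then xorv r' r else r) (nseq b false) ts in
  if [seq t <- ts | lookup t tbl == None] is u :: us then
    if all (pred1 u) us && ~~ odd (size us) then (u, r) :: tbl else tbl
  else tbl.

Fixpoint compositions n d : seq (seq nat) :=
  if n is n'.+1 then
    [seq i :: v | i <- iota 0 d.+1, v <- compositions n' (d - i)]
  else if d == 0 then [:: [::]] else [::].

Fixpoint parities n : seq (seq nat) :=
  if n is n'.+1 then [seq i :: v | i <- [:: 0; 1], v <- parities n'] else [:: [::]].

(* Enumerates the complement of [low]: [compositions] would be too many to filter. *)
Fixpoint not_low n rs d : seq (seq nat) :=
  if rs is r :: rs' then
    flatten [seq let k := sumn e in
       if (k < r) || (d < k) || odd (d - k) then [::] else
       [seq vadd e (map double v) |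
         v <- if k == r then not_low n rs' (d - k)./2 else compositions n (d - k)./2]
     | e <- parities n]
  else compositions n d.

Definition weight (a : seq nat) : nat := foldr (fun x w => x + w.*2) 0 a.

Definition free_orbits : seq (seq nat) :=
  [:: [:: 1; 17; 15; 11; 6];
      [:: 5; 11; 17; 11; 6];
      [:: 1; 29; 7; 2; 11];
      [:: 2; 19; 5; 9; 15];
      [:: 1; 27; 2; 13; 7];
      [:: 1; 31; 4; 3; 11];
      [:: 1; 15; 13; 2; 19];
      [:: 3; 19; 5; 11; 12];
      [:: 1; 3; 13; 23; 10];
      [:: 1; 11; 26; 5; 7];
      [:: 3; 9; 9; 7; 22];
      [:: 3; 9; 11; 4; 23];
      [:: 1; 23; 8; 11; 7];
      [:: 3; 3; 4; 25; 15];
      [:: 1; 7; 24; 15; 3];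
      [:: 0; 17; 11; 15; 7];
      [:: 5; 11; 19; 8; 7];
      [:: 2; 13; 21; 11; 3];
      [:: 1; 15; 11; 5; 18];
      [:: 1; 7; 10; 5; 27]].

(* The pairs (k, a) such that the equation L (Sq^k v^a) = 0 is used; each one
   solves for one new orbit, so the order matters. *)
Definition hit_sources : seq (nat * seq nat) :=
  [:: (1, [:: 3; 3; 7; 3; 33]); (1, [:: 3; 3; 17; 19; 7]); (4, [:: 1; 17; 7; 15; 6]);
      (4, [:: 3; 21; 11; 6; 5]); (4, [:: 2; 3; 5; 29; 7]); (4, [:: 5; 9; 7; 6; 19]);
      (8, [:: 2; 3; 13; 9; 15]); (2, [:: 2; 3; 25; 3; 15]); (4, [:: 3; 25; 7; 5; 6]);
      (1, [:: 1; 25; 3; 13; 7]); (4, [:: 3; 16; 7; 13; 7]); (1, [:: 1; 17; 15; 9; 7]);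
      (1, [:: 1; 29; 5; 3; 11]); (4, [:: 3; 3; 7; 28; 5]); (1, [:: 3; 3; 13; 25; 5]);
      (2, [:: 1; 11; 15; 2; 19]); (4, [:: 1; 15; 5; 6; 19]); (8, [:: 1; 9; 11; 15; 6]);
      (2, [:: 2; 3; 9; 27; 7]); (4, [:: 1; 1; 31; 7; 6]); (1, [:: 3; 19; 5; 9; 13]);
      (4, [:: 4; 7; 19; 5; 11]); (1, [:: 1; 9; 5; 7; 27]); (8, [:: 3; 3; 15; 8; 13]);
      (1, [:: 1; 13; 3; 3; 29]); (2, [:: 2; 13; 3; 3; 27]); (2, [:: 3; 3; 13; 23; 6]);
      (4, [:: 1; 3; 13; 15; 14]); (4, [:: 2; 5; 3; 13; 23]); (1, [:: 1; 9; 27; 5; 7]);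
      (2, [:: 3; 3; 11; 26; 5]); (4, [:: 1; 3; 30; 5; 7]); (1, [:: 1; 1; 31; 13; 3]);
      (4, [:: 1; 30; 5; 3; 7]); (8, [:: 3; 8; 11; 13; 7]); (1, [:: 1; 11; 13; 7; 17]);
      (2, [:: 3; 10; 13; 3; 19]); (4, [:: 1; 10; 5; 7; 23]); (4, [:: 1; 13; 7; 22; 3]);
      (8, [:: 6; 11; 9; 9; 7]); (4, [:: 1; 7; 6; 3; 29]); (2, [:: 3; 6; 3; 25; 11]);
      (4, [:: 3; 17; 15; 7; 4]); (2, [:: 2; 3; 17; 15; 11]); (4, [:: 2; 3; 21; 5; 15]);
      (4, [:: 3; 6; 3; 21; 13]); (1, [:: 3; 9; 9; 5; 23]); (4, [:: 1; 15; 4; 23; 3]);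
      (1, [:: 1; 13; 13; 19; 3]); (8, [:: 3; 11; 3; 12; 13]); (1, [:: 3; 11; 17; 5; 13]);
      (4, [:: 3; 3; 21; 7; 12]); (1, [:: 3; 3; 21; 13; 9]); (2, [:: 3; 3; 21; 11; 10]);
      (4, [:: 1; 13; 15; 10; 7]); (2, [:: 3; 11; 9; 15; 10]); (4, [:: 7; 9; 9; 7; 14]);
      (2, [:: 3; 11; 17; 3; 14]); (4, [:: 1; 6; 7; 11; 21]); (2, [:: 2; 7; 11; 17; 11]);
      (1, [:: 1; 7; 11; 17; 13]); (4, [:: 2; 7; 11; 13; 13]); (2, [:: 2; 7; 19; 5; 15]);
      (4, [:: 3; 11; 13; 5; 14]); (2, [:: 3; 19; 5; 7; 14]); (4, [:: 4; 5; 7; 11; 19]);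
      (1, [:: 1; 5; 7; 11; 25]); (4, [:: 0; 5; 7; 3; 31]); (1, [:: 1; 7; 3; 29; 9]);
      (2, [:: 2; 7; 3; 29; 7]); (1, [:: 1; 21; 9; 11; 7]); (2, [:: 3; 16; 11; 11; 7]);
      (4, [:: 0; 15; 7; 1; 23]); (1, [:: 1; 15; 7; 9; 17]); (2, [:: 0; 15; 3; 11; 19]);
      (4, [:: 4; 15; 7; 9; 11]); (1, [:: 7; 9; 9; 13; 11]); (2, [:: 0; 27; 15; 3; 3]);
      (4, [:: 3; 4; 25; 7; 7]); (8, [:: 0; 9; 15; 7; 11]); (1, [:: 1; 5; 25; 15; 3]);
      (2, [:: 1; 3; 26; 15; 3]); (4, [:: 1; 7; 24; 7; 7]); (1, [:: 1; 25; 7; 7; 9]);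
      (2, [:: 3; 11; 3; 24; 7]); (2, [:: 1; 27; 6; 3; 11]); (4, [:: 1; 26; 7; 7; 5]);
      (2, [:: 1; 26; 7; 11; 3]); (8, [:: 1; 8; 15; 3; 15]); (2, [:: 3; 3; 8; 15; 19]);
      (1, [:: 1; 1; 9; 15; 23]); (2, [:: 1; 11; 14; 19; 3]); (4, [:: 1; 8; 7; 23; 7]);
      (4, [:: 3; 8; 15; 15; 5]); (4, [:: 3; 5; 9; 6; 23]); (1, [:: 1; 17; 11; 15; 5]);
      (2, [:: 1; 19; 10; 11; 7]); (4, [:: 2; 15; 7; 5; 17]); (4, [:: 5; 9; 14; 11; 7]);
      (4, [:: 0; 9; 15; 15; 7]); (1, [:: 1; 9; 23; 11; 5]); (8, [:: 1; 1; 10; 15; 15]);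
      (1, [:: 5; 11; 17; 9; 7]); (2, [:: 3; 7; 11; 19; 8]); (4, [:: 3; 23; 8; 7; 5]);
      (1, [:: 1; 3; 21; 9; 15]); (2, [:: 2; 17; 11; 15; 3]); (1, [:: 1; 3; 17; 15; 13]);
      (2, [:: 1; 3; 19; 10; 15]); (2, [:: 3; 3; 23; 8; 11]); (1, [:: 3; 7; 19; 9; 11]);
      (2, [:: 3; 7; 17; 10; 11]); (4, [:: 3; 19; 14; 5; 5]); (1, [:: 3; 25; 11; 5; 5]);
      (2, [:: 1; 7; 3; 27; 10]); (4, [:: 1; 7; 7; 17; 14]); (4, [:: 0; 7; 7; 15; 17]);
      (2, [:: 0; 7; 15; 7; 19]); (1, [:: 5; 5; 15; 7; 17]); (2, [:: 3; 6; 15; 7; 17]);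
      (2, [:: 1; 6; 15; 3; 23]); (4, [:: 0; 15; 3; 7; 21]); (2, [:: 2; 15; 11; 3; 17]);
      (4, [:: 0; 7; 15; 3; 21]); (2, [:: 3; 15; 3; 17; 10]); (4, [:: 3; 17; 6; 5; 15]);
      (8, [:: 3; 5; 8; 15; 11]); (2, [:: 1; 10; 31; 3; 3]); (4, [:: 3; 5; 8; 23; 7]);
      (2, [:: 3; 8; 23; 7; 7]); (1, [:: 1; 13; 21; 7; 7]); (2, [:: 1; 11; 22; 7; 7]);
      (4, [:: 1; 14; 21; 7; 3]); (1, [:: 1; 3; 13; 21; 11]); (2, [:: 2; 9; 23; 11; 3]);
      (2, [:: 3; 3; 15; 20; 7]); (2, [:: 3; 7; 9; 22; 7]); (4, [:: 3; 5; 3; 15; 20]);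
      (1, [:: 3; 5; 11; 9; 21]); (4, [:: 1; 7; 9; 14; 15]); (2, [:: 3; 9; 14; 11; 11]);
      (4, [:: 3; 13; 12; 3; 15]); (2, [:: 3; 15; 7; 11; 12]); (4, [:: 3; 7; 13; 12; 11]);
      (2, [:: 3; 11; 11; 12; 11]); (1, [:: 1; 11; 9; 13; 15]); (4, [:: 3; 13; 4; 15; 11]);
      (4, [:: 3; 9; 14; 7; 13]); (4, [:: 2; 9; 23; 7; 5]); (1, [:: 3; 3; 3; 9; 31]);
      (1, [:: 1; 15; 11; 3; 19]); (2, [:: 1; 15; 7; 7; 18]); (1, [:: 5; 13; 7; 5; 19]);
      (2, [:: 7; 7; 14; 7; 13]); (2, [:: 3; 14; 7; 5; 19]); (2, [:: 1; 14; 3; 7; 23]);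
      (4, [:: 5; 10; 5; 15; 11]); (2, [:: 7; 7; 10; 13; 11]); (2, [:: 5; 6; 15; 11; 11]);
      (1, [:: 3; 7; 15; 15; 9]); (4, [:: 1; 7; 15; 5; 18]); (1, [:: 3; 15; 3; 19; 9]);
      (8, [:: 2; 9; 15; 11; 5]); (1, [:: 3; 3; 25; 7; 11]); (2, [:: 2; 25; 7; 7; 7]);
      (1, [:: 3; 29; 5; 7; 5]); (2, [:: 3; 7; 3; 31; 4]); (2, [:: 3; 7; 7; 25; 6]);
      (2, [:: 3; 7; 10; 5; 23]); (2, [:: 1; 7; 6; 7; 27]); (4, [:: 5; 7; 10; 5; 19]);
      (2, [:: 3; 10; 5; 15; 15]); (2, [:: 3; 6; 7; 19; 13]); (8, [:: 5; 11; 9; 7; 10]);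
      (2, [:: 3; 9; 7; 6; 23]); (1, [:: 3; 7; 23; 3; 13]); (4, [:: 7; 9; 7; 10; 13]);
      (2, [:: 3; 11; 7; 18; 9]); (1, [:: 1; 11; 5; 19; 13]); (4, [:: 5; 5; 11; 7; 18]);
      (1, [:: 1; 5; 11; 5; 27]); (2, [:: 3; 4; 7; 7; 27]); (2, [:: 3; 5; 11; 7; 22]);
      (1, [:: 3; 5; 15; 3; 23]); (8, [:: 5; 11; 7; 10; 9]); (1, [:: 3; 9; 5; 11; 21]);
      (2, [:: 3; 11; 4; 7; 23]); (2, [:: 5; 6; 7; 23; 7]); (1, [:: 3; 7; 11; 21; 7]);
      (2, [:: 2; 5; 7; 11; 23]); (4, [:: 4; 11; 13; 7; 11]); (1, [:: 5; 19; 9; 7; 9]);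
      (2, [:: 2; 11; 5; 19; 11]); (2, [:: 6; 19; 9; 7; 7]); (1, [:: 5; 5; 7; 19; 13]);
      (2, [:: 5; 7; 6; 15; 15]); (1, [:: 5; 9; 5; 15; 15]); (2, [:: 0; 7; 7; 19; 15]);
      (1, [:: 1; 7; 7; 23; 11]); (2, [:: 2; 7; 7; 23; 9]); (1, [:: 5; 7; 23; 7; 7]);
      (2, [:: 1; 11; 7; 14; 15]); (1, [:: 1; 15; 3; 15; 15]); (2, [:: 3; 15; 5; 14; 11]);
      (4, [:: 2; 11; 5; 15; 13]); (1, [:: 3; 11; 13; 11; 11]); (2, [:: 2; 7; 15; 11; 13]);
      (2, [:: 2; 11; 13; 7; 15]); (1, [:: 7; 9; 13; 7; 13]); (2, [:: 2; 15; 7; 9; 15]);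
      (1, [:: 3; 15; 7; 13; 11]); (2, [:: 2; 15; 3; 15; 13]); (1, [:: 3; 15; 11; 7; 13]);
      (4, [:: 5; 6; 11; 13; 11]); (2, [:: 3; 6; 11; 13; 15]); (1, [:: 5; 5; 11; 13; 15]);
      (2, [:: 4; 7; 15; 15; 7]); (1, [:: 3; 5; 7; 15; 19]); (2, [:: 5; 11; 15; 10; 7]);
      (1, [:: 5; 15; 11; 11; 7]); (2, [:: 3; 7; 15; 13; 10]); (1, [:: 1; 7; 15; 11; 15]);
      (8, [:: 3; 9; 6; 11; 13]); (1, [:: 3; 7; 7; 27; 5]); (2, [:: 3; 9; 6; 23; 7]);
      (1, [:: 3; 11; 5; 23; 7])].

(* The digit counts of the monomial of degree 50 = 4 + 2 * 3 + 4 * 2 + 8 * 2 + 16 with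
   fewest factors at each level that the chi-trick leaves. *)
Definition levels := [:: 4; 3; 2; 2].
Definition pred5 j := (j + 4) %% 5.

Definition orbit_table :=
  foldl (hit_step pred5 levels 20)
    [seq (nth [::] free_orbits i, mkseq (fun j => j == i) 20) | i <- iota 0 20] hit_sources.

Local Open Scope ring_scope.

(** * Correctness of the hit equations *)

(** In characteristic 2 the a-th power of x + y is the (a/2)-th power of x^2 + y^2, times x + y if a
    is odd; recursion on binary digits then takes the place of the theorem of Lucas. *)
Lemma odd_binsP fuel a : (a <= fuel)%N ->
  (forall i, i \in odd_bins fuel a -> (i <= a)%N) /\
  (forall (R : comNzRingType) (x y : R), 2%N \in [pchar R] ->
     (x + y) ^+ a = \sum_(i <- odd_bins fuel a) x ^+ (a - i) * y ^+ i).
Proof.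
elim: fuel a => [|fuel IH] a /=.
  rewrite leqn0 => /eqP->; split=> [i|R x y _]; first by rewrite inE => /eqP->.
  by rewrite big_seq1 !expr0 mulr1.
case: eqP => [-> _|/eqP a0 le_a].
  by split=> [i|R x y _]; [rewrite inE => /eqP-> | rewrite big_seq1 !expr0 mulr1].
have le_h : (a./2 <= fuel)%N by lia.
have [IHle IHb] := IH _ le_h.
have aE := odd_double_half a.
split=> [i|R x y c2].
  rewrite mem_cat => /orP[/mapP[j /IHle le_j ->]|].
    by rewrite -aE (leq_trans _ (leq_addl _ _)) // leq_double.
  case oa: (odd a) => // /mapP[j /IHle le_j ->].
  by rewrite -aE oa ltnS leq_double.
have half_sum : ((x ^+ 2 + y ^+ 2) ^+ a./2 =
   \sum_(i <- odd_bins fuel a./2) x ^+ (a./2.*2 - i.*2) * y ^+ i.*2).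
  rewrite (IHb _ _ _ c2) big_seq [RHS]big_seq; apply: eq_bigr => i /IHle le_i.
  by rewrite -doubleB -!exprM !mul2n.
rewrite big_cat big_map /= -[in LHS]aE exprD -mul2n exprM (sqrD_char2 c2) half_sum.
rewrite [X in _ = _ + X](_ : _ = if odd a then
    \sum_(i <- odd_bins fuel a./2) x ^+ (a - i.*2.+1) * y ^+ i.*2.+1 else 0); last first.
  by case: odd; rewrite ?big_map ?big_nil.
case oa: (odd a); last first.
  by rewrite expr0 mul1r addr0; move: aE; rewrite oa add0n => ->.
rewrite expr1 mulrDl !mulr_sumr; congr (_ + _); rewrite big_seq [RHS]big_seq.
  apply: eq_bigr => i /IHle le_i; rewrite mulrA -exprS -[in RHS]aE oa.
  by rewrite -subSn ?leq_double.
apply: eq_bigr => i /IHle le_i; rewrite mulrCA -exprS -[in RHS]aE oa.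
by rewrite subSS.
Qed.

Section ListMonomials.
Variables (R : comNzRingType) (n : nat) (s : {perm 'I_n}) (sh : nat -> nat).
Hypothesis s_sh : forall j, s j = sh j :> nat.
Hypothesis R2 : 2%N \in [pchar R].
Local Notation P := {mpoly R[n]}.

Definition lmon (a : seq nat) : 'X_{1..n} := [multinom nth 0%N a i | i < n].
Definition Xl (a : seq nat) : P := 'X_[lmon a].

Lemma nth_vadd u v i : size u = size v -> nth 0%N (vadd u v) i = (nth 0 u i + nth 0 v i)%N.
Proof.
move=> suv; have [lt_i|ge_i] := ltnP i (size u).
  by rewrite (nth_map (0, 0)%N) ?size_zip -?suv ?minnn // nth_zip.
by rewrite !nth_default -?suv // size_map size_zip -suv minnn.
Qed.

Lemma size_vadd u v : size u = size v -> size (vadd u v) = size u.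
Proof. by move=> suv; rewrite size_map size_zip -suv minnn. Qed.

Lemma Xl_vadd u v : size u = size v -> Xl (vadd u v) = Xl u * Xl v.
Proof.
move=> suv; rewrite /Xl -mpolyXD; congr 'X_[_]; apply/mnmP => i.
by rewrite mnmDE !mnmE nth_vadd.
Qed.

Lemma Xl_term (j : 'I_n) x y : Xl (vterm n sh j x y) = 'X_j ^+ x * 'X_(s j) ^+ y.
Proof.
rewrite /Xl !mpolyXn -mpolyXD; congr 'X_[_]; apply/mnmP => i.
rewrite mnmDE !mulmnE !mnm1E mnmE nth_mkseq // -s_sh !val_eqE ![_ == i]eq_sym.
by case: (i == j); case: (i == s j); rewrite ?mul1n ?mul0n.
Qed.

Lemma size_sq_terms k js v : v \in sq_terms n sh k js -> size v = n.
Proof.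
elim: js k v => [|[j a] js IH] k v /=.
  by case: (k == 0%N) => //; rewrite inE => /eqP ->; rewrite size_nseq.
case/flatten_mapP => i _ /mapP[u /IH szu ->].
by rewrite size_vadd size_mkseq.
Qed.

Lemma sq_termsP k (js : seq 'I_n) (e : 'I_n -> nat) :
  (\prod_(j <- js) tsq s ('X_j : P) ^+ e j)`_k =
    \sum_(v <- sq_terms n sh k [seq (val j, e j) | j <- js]) Xl v.
Proof.
elim: js k => [|j js IH] k.
  rewrite big_nil coef1 /=; case: (k == 0%N); rewrite ?big_nil // big_seq1.
  rewrite /Xl -mpolyX0; congr 'X_[_]; apply/mnmP => i.
  by rewrite mnm0E mnmE nth_nseq if_same.
rewrite big_cons /= big_flatten big_map big_filter.
have cP : 2%N \in [pchar {poly P}].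
  by rewrite pchar_poly (rmorph_pchar (@mpolyC n R)).
have [le_e eE] := odd_binsP (leqnn (e j)).
rewrite tsqXU (eE _ _ _ cP) mulr_suml coef_sum [RHS]big_mkcond /=.
apply: eq_bigr => i _; rewrite exprMn -!rmorphXn /= mulrA -rmorphM /= -exprM mul2n.
rewrite -mulrA coefCM coefXnM ltnNge; case: leqP => [le_ik|_]; last by rewrite mulr0.
rewrite /= IH mulr_sumr big_map big_seq [RHS]big_seq; apply: eq_bigr => v vin.
by rewrite Xl_vadd ?Xl_term // size_mkseq (size_sq_terms vin).
Qed.

Lemma sq_listP k a : size a = n -> (tsq s (Xl a))`_k = \sum_(v <- sq_list sh k a) Xl v.
Proof.
move=> sza; rewrite {1}/Xl mpolyXE_id rmorph_prod /= -big_enum /=.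
under eq_bigr => j _ do rewrite rmorphXn /= mnmE.
rewrite (sq_termsP k (enum 'I_n) (fun j => nth 0%N a j)); congr (\sum_(v <- _) _).
rewrite /sq_list sza; congr sq_terms.
apply: (@eq_from_nth _ (0, 0)%N) => [|i].
  by rewrite size_map size_zip size_iota size_enum_ord sza minnn.
rewrite size_map size_enum_ord => lt_in.
rewrite nth_zip ?size_iota ?sza // nth_iota // add0n.
have i0 : 'I_n := Ordinal lt_in.
rewrite (nth_map i0) ?size_enum_ord //.
by congr (_, nth _ _ _); exact: nth_enum_ord.
Qed.

End ListMonomials.

Lemma mem_compositions n d v : size v = n -> sumn v = d -> v \in compositions n d.
Proof.
elim: n d v => [|n IH] d; first by case=> // _ <-.
case=> // x v [szv] <-; set e := sumn _.
rewrite -[compositions _ _]/[seq i :: v | i <- iota 0 e.+1, v <- compositions n (e - i)]%N.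
apply/allpairsPdep; exists x, v; split=> //; last by apply: IH; rewrite ?addKn.
by rewrite mem_iota /= ltnS leq_addr.
Qed.

Lemma mem_parities n v : size v = n -> all (fun x => x < 2)%N v -> v \in parities n.
Proof.
elim: n v => [|n IH]; first by case.
case=> // x v [szv] /andP[x2 v2].
rewrite -[parities _]/[seq i :: v | i <- [:: 0; 1], v <- parities n]%N.
apply/allpairsPdep; exists x, v; split=> //; last exact: IH.
by case: x x2 => [|[|]].
Qed.

Lemma parity_decomp a :
  a = vadd [seq nat_of_bool (odd x) | x <- a] (map double (map half a)).
Proof.
elim: a => //= x a IH; rewrite /vadd /= -/(vadd _ _) -IH; congr (_ :: _).
by rewrite odd_double_half.
Qed.

Lemma sumn_parity a : sumn a = (count odd a + (sumn (map half a)).*2)%N.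
Proof.
elim: a => //= x a ->; rewrite -{1}(odd_double_half x) doubleD.
by rewrite addnACA.
Qed.

(** Completeness of the enumeration, by splitting [a] into its parities and twice its halves, as the
    recursion does. *)
Lemma mem_not_low n rs d a :
  size a = n -> sumn a = d -> ~~ low rs a -> a \in not_low n rs d.
Proof.
elim: rs d a => [|r rs IH] d a sza suma /=; first by rewrite mem_compositions.
rewrite negb_or -leqNgt => /andP[le_r nlow].
apply/flatten_mapP; exists [seq nat_of_bool (odd x) | x <- a].
  by apply: mem_parities; rewrite ?size_map //; apply/allP => _ /mapP[x _ ->]; case: odd.
have sumE : sumn [seq nat_of_bool (odd x) | x <- a] = count odd a.
  by elim: (a) => //= x l ->.
have half_d : (d - count odd a)./2 = sumn (map half a).
  by rewrite -suma sumn_parity addKn doubleK.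
rewrite sumE; have -> : ((count odd a < r) || (d < count odd a) || odd (d - count odd a))%N = false.
  by rewrite -suma sumn_parity addKn odd_double ltnNge le_r ltnNge leq_addr.
apply/mapP; exists (map half a); last exact: parity_decomp.
rewrite half_d; case: eqP nlow => [_|_ _]; last first.
  by apply: mem_compositions; rewrite ?size_map.
by apply: IH; rewrite ?size_map.
Qed.

Section LowMonomials.
Variables (F : comNzRingType) (n : nat) (s : {perm 'I_n}) (A : zmodType).
Hypothesis F_le1 : forall c : F, c = 0 \/ c = 1.
Local Notation P := {mpoly F[n]}.

Lemma lmonK a : size a = n -> [seq lmon n a i | i <- enum 'I_n] = a.
Proof.
move=> sza; apply: (@eq_from_nth _ 0%N); rewrite size_map size_enum_ord // => i lt_in.
by rewrite (nth_map (Ordinal lt_in)) ?size_enum_ord // mnmE nth_enum_ord.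
Qed.

Lemma size_modds_lmon a : size a = n -> size (modds (lmon n a)) = count odd a.
Proof. by move=> sza; rewrite size_filter -[in RHS](lmonK sza) count_map. Qed.

Lemma mhalf_lmon a : size a = n -> mhalf (lmon n a) = lmon n (map half a).
Proof.
by move=> sza; apply/mnmP => i; rewrite mhalfE !mnmE (nth_map 0%N) // sza.
Qed.

(** Splitting off [r] odd factors and taking the root of the remaining square leads from degree [d]
    to [(d - r)./2], where the next level applies. *)
Fixpoint levels_ok d rs : Prop :=
  if rs is r :: rs' then
    [/\ forall ks, (size ks < r)%N -> ((\sum_(j <- ks) 2 ^ j).*2 != d + size ks)%N,
        d = (r + (d - r)./2.*2)%N & levels_ok (d - r)./2 rs']
  else True.

(** With fewer than [r] odd exponents the chi-trick applies. With exactly [r] of them, [descend]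
    gives a functional of degree [(d - r)./2] on the halved exponents, and induction applies. *)
Lemma low_kills rs d (L : {additive P -> A}) a :
  kills_hits s L -> concentrated d L -> levels_ok d rs ->
  size a = n -> low rs a -> L (Xl F n a) = 0.
Proof.
elim: rs d L a => [//|r rs IH] d L a Lh Ld [no_sum dE ok] sza /=.
have Lr := kills_fewer_oddP F_le1 Lh Ld no_sum.
rewrite /Xl mpolyX_half; case/orP=> [lt_r|/andP[/eqP cr lo]].
  by apply: Lr; rewrite size_modds_lmon.
have szE : size (modds (lmon n a)) = r by rewrite size_modds_lmon.
rewrite mhalf_lmon //.
apply: (IH (d - r)./2 (descend F_le1 L (modds (lmon n a))) (map half a)) => //.
- exact (kills_hits_descend F_le1 Lh Lr szE).
- move=> m dm; rewrite /= /descend mpolyXn /XE mprodXE -mpolyXD; apply: Ld.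
  apply: contra_neq dm; rewrite mdegD mdegMn mdeg_sum muln2 {1}dE.
  rewrite (eq_bigr (fun=> 1%N)) ?sum1_size ?szE => [|i _]; last by rewrite mdeg1.
  by move/addnI/double_inj.
by rewrite size_map.
Qed.

End LowMonomials.

Lemma shift5E (j : 'I_5) : shift_perm 5 j = pred5 j :> nat.
Proof. by rewrite permE /= /pred5 addnS. Qed.

Section OrbitTable.
Variables (F : comNzRingType) (A : comNzRingType).
Hypotheses (F_le1 : forall c : F, c = 0 \/ c = 1) (A2 : 2%N \in [pchar A]).
Variables (rs : seq nat) (d : nat) (B : seq (seq nat)).
Hypothesis ok : levels_ok d rs.
Local Notation P := {mpoly F[5]}.
Local Notation b := (size B).

(** The properties that averaging provides; the last two come from the Singer cycle and from
    Frobenius. *)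
Definition admissible (L : {additive P -> A}) :=
  [/\ kills_hits (shift_perm 5) L, concentrated d L,
      forall m, ~~ (2 ^ 5 - 1 %| wt m)%N -> L 'X_[m] = 0 &
      forall m, L 'X_[mrot m] = L 'X_[m]].

Definition combination (L : P -> A) (r : seq bool) : A :=
  \sum_(j < b) if nth false r j then L (Xl F 5 (nth [::] B j)) else 0.

Variable L : {additive P -> A}.
Hypothesis La : admissible L.

Lemma admissible_rot i a : size a = 5%N -> L (Xl F 5 (rot i a)) = L (Xl F 5 a).
Proof.
case: La => _ _ _ Lrot sza.
have rot1 v : size v = 5%N -> L (Xl F 5 (rot 1 v)) = L (Xl F 5 v).
  move=> szv; rewrite -Lrot; congr (L 'X_[_]); apply/mnmP => j.
  case: v szv => [|v0 [|v1 [|v2 [|v3 [|v4 [|]]]]]] // _.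
  by case: j => [[|[|[|[|[|//]]]]] lt]; rewrite !mnmE.
have [le_i|lt_i] := leqP i (size a); last by rewrite rot_oversize // ltnW.
elim: i le_i => [|i IH] lt_i; first by rewrite rot0.
by rewrite rotS // rot1 ?size_rot // IH // ltnW.
Qed.

Lemma admissible_rot_min a : size a = 5%N ->
  size (rot_min a) = 5%N /\ L (Xl F 5 (rot_min a)) = L (Xl F 5 a).
Proof.
move=> sza; rewrite /rot_min; move: (iota _ _) => l.
set f := fun _ _ => _.
have H m : size m = 5%N -> L (Xl F 5 m) = L (Xl F 5 a) ->
    size (foldl f m l) = 5%N /\ L (Xl F 5 (foldl f m l)) = L (Xl F 5 a).
  elim: l m => [|i l IH] m //= szm Lm; rewrite {2 4}/f.
  by apply: IH; rewrite /f; case: ifP; rewrite ?size_rot ?admissible_rot.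
exact: H.
Qed.

Definition table_ok tbl := forall t r, lookup t tbl = Some r ->
  size r = b /\ L (Xl F 5 t) = combination L r.

Lemma combination_xor r r' : size r = b -> size r' = b ->
  combination L (xorv r r') = combination L r + combination L r'.
Proof.
move=> szr szr'; rewrite -big_split; apply: eq_bigr => j _ /=.
rewrite (nth_map (false, false)) ?size_zip ?szr ?szr' ?minnn //.
rewrite nth_zip ?szr //=.
by case: (nth _ r j); case: (nth _ r' j); rewrite /= ?addr0 ?add0r // (addrr_char2 A2).
Qed.

Lemma combination0 k : combination L (nseq k false) = 0.
Proof. by apply: big1 => j _; rewrite nth_nseq if_same. Qed.

(** The values on the terms of Sq^k v^a add up to 0. Low terms vanish, tabulated ones add up to [r],
    and the unknown orbit occurs an odd number of times, so its value is the combination [r]. *)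
Lemma hit_step_ok tbl src : (0 < src.1)%N -> size src.2 = 5%N ->
  table_ok tbl -> table_ok (hit_step pred5 rs b tbl src).
Proof.
case: src => k a /= k0 sza tok; rewrite /hit_step /=.
set ts := [seq rot_min t | t <- _ & _].
have ts0 : \sum_(t <- ts) L (Xl F 5 t) = 0.
  case: (La) => Lh Ld _ _.
  have F2 : 2%N \in [pchar F].
    rewrite inE /=; case: (F_le1 2%:R) => [->|/eqP]; first exact: eqxx.
    by rewrite -subr_eq0 (natrD _ 1 1) addrK oner_eq0.
  have := Lh k (Xl F 5 a) k0; rewrite (sq_listP shift5E F2 k sza) raddf_sum => sum0.
  rewrite big_map big_filter big_seq_cond -[RHS]sum0 [RHS]big_seq.
  rewrite [RHS](bigID (fun t => low rs t)) /= [X in _ = X + _]big1 ?add0r => [|t /andP[tin lo]].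
    apply: eq_bigr => t /andP[tin _]; apply: (admissible_rot_min _).2.
    by rewrite -sza; apply: size_sq_terms tin.
  have szt : size t = 5%N by rewrite -sza; apply: size_sq_terms tin.
  exact (low_kills F_le1 Lh Ld ok szt lo).
set r := foldr _ _ _; set unk := [seq t <- ts | _].
have [szr sumE] : size r = b /\
    \sum_(t <- ts) L (Xl F 5 t) = combination L r + \sum_(t <- unk) L (Xl F 5 t).
  rewrite /r /unk; elim: (ts) => [|t l [szr IH]] /=.
    by rewrite size_nseq !big_nil combination0 addr0.
  rewrite big_cons IH; case E: (lookup t tbl) => [r'|] /=.
    have [szr' ->] := tok _ _ E; rewrite combination_xor // addrA.
    by rewrite size_map size_zip szr szr' minnn.
  by rewrite big_cons addrCA.
case unkE: unk => [//|u us]; case: ifP => // /andP[/allP all_u odd_us] t r' /=.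
case: eqP => [<- [<-]|_]; last exact: tok.
split=> //; move: sumE; rewrite ts0 unkE big_cons.
(* The further copies of [u] are even in number and cancel. *)
have -> : \sum_(t <- us) L (Xl F 5 t) = 0.
  rewrite big_seq (eq_bigr (fun=> L (Xl F 5 u))) => [|v /all_u/eqP -> //].
  rewrite -big_seq big_const_seq count_predT iter_addr_0 -(odd_double_half (size us)).
  by rewrite (negbTE odd_us) add0n -mul2n mulrnA mulr2n (addrr_char2 A2) mul0rn.
rewrite addr0 => /esym/eqP; rewrite addr_eq0 => /eqP e.
by rewrite e (oppr_pchar2 A2).
Qed.

Lemma free_table_ok :
  table_ok [seq (nth [::] B i, mkseq (fun j => j == i) b) | i <- iota 0 b].
Proof.
have lookupP t tbl r : lookup t tbl = Some r -> (t, r) \in tbl.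
  elim: tbl => [|[u v] tbl IH] //=; rewrite in_cons; case: eqP => [-> [->]|_ /IH ->].
    by rewrite eqxx.
  by rewrite orbT.
move=> t r /lookupP/mapP[i]; rewrite mem_iota /= add0n => lt_i [-> ->].
split; first by rewrite size_mkseq.
rewrite /combination (bigD1 (Ordinal lt_i)) //= nth_mkseq // eqxx big1 ?addr0 //.
by move=> j ne_ji; rewrite nth_mkseq // -val_eqE /= in ne_ji *; rewrite (negbTE ne_ji).
Qed.

Lemma fold_hit_step_ok tbl srcs :
  all (fun src => (0 < src.1)%N && (size src.2 == 5%N)) srcs ->
  table_ok tbl -> table_ok (foldl (hit_step pred5 rs b) tbl srcs).
Proof.
elim: srcs tbl => [|src srcs IH] tbl //= /andP[/andP[k0 /eqP sza] all_ok] tok.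
exact/IH/hit_step_ok.
Qed.

End OrbitTable.

Fixpoint popcount fuel k : nat :=
  if fuel is fuel'.+1 then (odd k + popcount fuel' k./2)%N else 0%N.

(** Too little fuel only drops digits, so the bound holds for any [fuel]. *)
Lemma popcount_le fuel ks : (popcount fuel (\sum_(j <- ks) 2 ^ j) <= size ks)%N.
Proof.
suff H N ls : (\sum_(j <- ls) 2 ^ j = N -> popcount fuel N <= size ls)%N by exact: H.
elim: fuel N ls => [|fuel IH] N ls //= e.
have [even_ok odd_ok] := pow2_sum_double (IH N./2).
have := odd_double_half N; case oN: (odd N) => N_E /=.
  by rewrite add1n; apply: odd_ok; rewrite e -[LHS]N_E.
by rewrite add0n; apply: even_ok; rewrite e -[LHS]N_E.
Qed.

(** Equality would make [(d + k)./2] a sum of [k] powers of 2. For each [k < r] this fails by parity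
    of [d + k] or because there are more than [k] binary digits 1. *)
Lemma levels_ok50 : levels_ok 50 levels.
Proof.
have lev d r : all (fun k => ((d + k)./2.*2 != d + k) ||
        (k < popcount 10 (d + k)./2))%N (iota 0 r) ->
    forall ks, (size ks < r)%N -> ((\sum_(j <- ks) 2 ^ j).*2 != d + size ks)%N.
  move=> /allP chk ks lt_r; have := chk (size ks); rewrite mem_iota add0n => /(_ lt_r).
  apply: contraL => /eqP e; rewrite negb_or negbK -e doubleK eqxx -leqNgt andTb.
  exact: popcount_le.
split; [exact: lev | by [] | split; [exact: lev | by [] |]].
by split; [exact: lev | by [] | split; [exact: lev | by [] |]].
Qed.

Lemma weightE a : size a = 5%N -> weight a = wt (lmon 5 a).
Proof.
case: a => [|a0 [|a1 [|a2 [|a3 [|a4 [|]]]]]] // _.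
by rewrite /wt !big_ord_recl big_ord0 !mnmE /= /bump /=; lia.
Qed.

Definition orbits_covered tbl :=
  all (fun a => if weight a %% 31 == 0 then isSome (lookup (rot_min a) tbl) else true)%N
    (not_low 5 levels 50).

Lemma covered_lookup tbl a : orbits_covered tbl ->
  size a = 5%N -> sumn a = 50%N -> ~~ low levels a -> (weight a %% 31 = 0)%N ->
  exists r, lookup (rot_min a) tbl = Some r.
Proof.
move=> /allP cov sza suma nlo wa; have := cov a (mem_not_low sza suma nlo).
by rewrite wa eqxx; case: (lookup _ _) => [r|//] _; exists r.
Qed.

Lemma orbit_table_covers : orbits_covered orbit_table.
Proof. by vm_compute. Qed.

Lemma hit_sources_ok : all (fun src => (0 < src.1)%N && (size src.2 == 5%N)) hit_sources.
Proof. by []. Qed.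

(** The row [r] is found before [L] is given. Monomials of wrong degree, low ones and those of
    weight prime to 31 get the empty row, whose missing entries default to [false]; the table covers
    the rest. *)
Lemma orbit_span (F A : comNzRingType) (a : seq nat) :
  (forall c : F, c = 0 \/ c = 1) -> 2%N \in [pchar A] -> size a = 5%N ->
  exists r, forall L : {additive {mpoly F[5]} -> A}, admissible 50 L ->
    L (Xl F 5 a) = combination free_orbits L r.
Proof.
move=> F_le1 A2 sza.
have zero (L : {additive {mpoly F[5]} -> A}) : combination free_orbits L [::] = 0.
  by apply: big1 => j _; rewrite nth_nil.
have [suma|suma] := eqVneq (sumn a) 50%N; last first.
  exists [::] => L [_ Ld _ _]; rewrite zero; apply: Ld; apply: contra_neq suma => <-.
  by rewrite -[in LHS](lmonK sza) sumnE big_map big_enum mdegE.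
have [lo|nlo] := boolP (low levels a).
  exists [::] => L [Lh Ld _ _]; rewrite zero.
  exact (low_kills F_le1 Lh Ld levels_ok50 sza lo).
have [wa|wa] := eqVneq (weight a %% 31)%N 0%N; last first.
  exists [::] => L [_ _ Lw _]; rewrite zero; apply: Lw.
  by rewrite -weightE.
have [r rE] := covered_lookup orbit_table_covers sza suma nlo wa.
exists r => L La; have [_ <-] := admissible_rot_min La sza.
have tok : table_ok free_orbits L orbit_table.
  exact (fold_hit_step_ok F_le1 A2 levels_ok50 La hit_sources_ok (free_table_ok L)).
exact (proj2 (tok _ _ rE)).
Qed.

Local Open Scope nat_scope.

(** * Evaluation of the averaged functional *)

Section Permanent.
Variables (T : Type) (add mul : T -> T -> T) (zero one : T) (L : nat -> nat -> T).

Fixpoint permanent (E O : seq nat) : T :=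
  if E is j :: E' then
    foldr (fun l s => add (mul (L j l) (permanent E' (rem l O))) s) zero O
  else one.

Definition odds (a : seq nat) := [seq j <- iota 0 (size a) | odd (nth 0 a j)].

(* The coefficient of u^t in prod_j (sum_l L j l u_l) ^ b_j, by recursion on the
   binary digits: modulo 2 the linear factors with an odd exponent must account
   for exactly the odd entries of [t], provided [form_coef_ok]. *)
Fixpoint form_coef fuel (b t : seq nat) : T :=
  if fuel is fuel'.+1 then
    let E := odds b in let O := odds t in
    if size E == size O then
      let r := form_coef fuel' (map half b) (map half t) in
      mul (permanent E O) (mul r r)
    else zero
  else if all (eq_op 0) t then one else zero.

End Permanent.

Fixpoint form_coef_ok fuel (b t : seq nat) : bool :=
  if fuel is fuel'.+1 then
    (size (odds b) < size (odds t)) ||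
    (size (odds b) == size (odds t)) && form_coef_ok fuel' (map half b) (map half t)
  else all (eq_op 0) b.

(* The functional y is the sum of the dual basis elements of these monomials;
   it was found by solving the equations [y (Sq^k u^a) = 0]. *)
Definition y_terms : seq (seq nat) :=
  [:: [:: 3; 1; 1; 14; 31]; [:: 3; 2; 1; 13; 31]; [:: 5; 2; 1; 11; 31];
      [:: 6; 1; 1; 11; 31]; [:: 7; 3; 2; 7; 31]; [:: 7; 4; 1; 7; 31];
      [:: 9; 2; 1; 7; 31]; [:: 10; 1; 1; 7; 31]].

(** Without a shift, the term of index [i] in the total square of u^a is u^(a+i), so [i = x - a]. *)
Definition preimages1 x := [seq a <- iota 0 x.+1 | x - a \in odd_bins a a].

(* Contains every [a] such that u^v occurs in some Sq^k u^a. *)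
Fixpoint preimages (v : seq nat) : seq (seq nat) :=
  if v is x :: v' then [seq a :: w | a <- preimages1 x, w <- preimages v'] else [:: [::]].

(** Only [k = 50 - sumn a] leads from [a] to degree 50, and the case [k = 0] is no hit. *)
Definition y_check :=
  all (fun v => all (fun a => (50 - sumn a == 0) ||
     ~~ odd (count (mem y_terms) (sq_list id (50 - sumn a) a))) (preimages v)) y_terms.

Definition zpow i := iter i F32.mulz F32.one.
Definition pow2 j x := iter j (fun y => F32.mul y y) x.
Definition trace32 x := foldr (fun j s => F32.add (pow2 j x) s) F32.zero (iota 0 5).
Definition delta32 (c : bool) := if c then F32.one else F32.zero.

(* Dual bases for the trace form. *)
Definition basis32 := map zpow [:: 0; 1; 2; 3; 4].
Definition dual32 := map zpow [:: 26; 25; 29; 28; 27].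

Definition perms : seq (seq nat) :=
  [:: [:: 0; 1; 2; 3; 4]; [:: 0; 1; 2; 4; 3]; [:: 0; 1; 3; 2; 4]; [:: 0; 1; 3; 4; 2];
      [:: 0; 1; 4; 2; 3]; [:: 0; 1; 4; 3; 2]; [:: 0; 2; 1; 3; 4]; [:: 0; 2; 1; 4; 3];
      [:: 0; 2; 3; 1; 4]; [:: 0; 2; 3; 4; 1]; [:: 0; 2; 4; 1; 3]; [:: 0; 2; 4; 3; 1];
      [:: 0; 3; 1; 2; 4]; [:: 0; 3; 1; 4; 2]; [:: 0; 3; 2; 1; 4]; [:: 0; 3; 2; 4; 1];
      [:: 0; 3; 4; 1; 2]; [:: 0; 3; 4; 2; 1]; [:: 0; 4; 1; 2; 3]; [:: 0; 4; 1; 3; 2];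
      [:: 2; 1; 0; 4; 3]].

(* [nth combos i] lists rows of [y_matrix] adding up to the i-th unit vector; there
   is an even number of them, so they add up to 0 on the other side. *)
Definition combos : seq (seq nat) :=
  [:: [:: 0; 2; 5; 7; 8; 9; 10; 11; 13; 14; 16; 18];
      [:: 1; 2; 5; 7; 8; 11; 13; 14; 15; 17; 18; 19];
      [:: 0; 1; 2; 6; 8; 9; 11; 12; 15; 18; 19; 20];
      [:: 1; 3; 5; 6; 7; 8; 9; 11; 12; 13; 16; 19];
      [:: 0; 3; 5; 6; 10; 14; 18; 19];
      [:: 0; 2; 7; 9; 10; 19];
      [:: 1; 3; 4; 5; 7; 8; 9; 11; 12; 14; 17; 19];
      [:: 0; 1; 2; 5; 10; 12; 14; 15; 17; 19];
      [:: 0; 3; 5; 7; 8; 9; 11; 14; 15; 16; 17; 18];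
      [:: 1; 3; 5; 12; 14; 15];
      [:: 0; 4; 7; 9; 12; 14; 16; 19];
      [:: 0; 3; 7; 9; 12; 18];
      [:: 1; 5; 6; 7; 10; 11; 13; 16; 18; 20];
      [:: 2; 8; 10; 13; 14; 16; 17; 18];
      [:: 6; 8; 9; 11; 13; 14; 16; 17; 19; 20];
      [:: 1; 3; 7; 9; 12; 16];
      [:: 1; 2; 3; 4; 8; 10; 13; 14; 15; 17];
      [:: 0; 1; 3; 4; 5; 8; 10; 12; 13; 14; 16; 20];
      [:: 0; 1; 2; 4; 5; 6; 8; 10; 13; 15; 16; 18];
      [:: 0; 1; 3; 4; 6; 10; 12; 15; 17; 18]].

Definition permuted (l : seq F32) (u : seq nat) := [seq nth F32.zero l i | i <- u].

Definition dual_check u :=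
  let p := permuted basis32 u in let p' := permuted dual32 u in
  all (fun l => all (fun l' =>
    trace32 (F32.mul (nth F32.zero p' l) (nth F32.zero p l')) == delta32 (l == l'))
    (iota 0 5)) (iota 0 5).

(** [L] tabulates the Moore matrix of the permuted basis. The inner sum is the value of y on the
    monomial v^b, and the trace is what averaging makes of it. *)
Definition y_value (u b : seq nat) : F32 :=
  let p := permuted basis32 u in
  let L := [seq [seq pow2 j x | x <- p] | j <- iota 0 5] in
  trace32 (foldr (fun t s => F32.add
    (form_coef F32.add F32.mul F32.zero F32.one (fun j l => nth F32.zero (nth [::] L j) l) 5 b t) s)
    F32.zero y_terms).

Definition y_matrix := [seq [seq y_value u b | b <- free_orbits] | u <- perms].

Definition combos_check (W : seq (seq F32)) :=
  all (fun i => let S := nth [::] combos i in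
    ~~ odd (size S) && all (fun k => k < 21) S &&
    all (fun j => foldr (fun k s => F32.add (nth F32.zero (nth [::] W k) j) s) F32.zero S
                  == delta32 (i == j)) (iota 0 20)) (iota 0 20).

(** * Correctness of the coefficient formula *)

Local Open Scope ring_scope.

Section FormCoefficients.
Variables (A : comNzRingType) (n : nat).
Hypothesis A2 : 2%N \in [pchar A].
Local Notation P := {mpoly A[n]}.
Implicit Types (H : P) (m : 'X_{1..n}).
Local Notation perm_sum := (permanent +%R *%R (0 : A) 1).

Lemma mcoeff_sqr H m :
  (H ^+ 2)@_m = if modds m == [::] then H@_(mhalf m) ^+ 2 else 0.
Proof.
have P2 : 2%N \in [pchar P] by rewrite (rmorph_pchar (@mpolyC n A)).
elim/mpolyind: H => [|c k H _ _ IH].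
  by rewrite expr0n !mcoeff0 expr0n if_same.
rewrite (sqrD_char2 P2) !mcoeffD (sqrD_char2 A2) IH exprZn mpolyXn !mcoeffZ !mcoeffX exprMn.
suff -> : (k *+ 2 == m :> 'X_{1..n})%MM = (modds m == [::]) && (k == mhalf m).
  by case: (modds m == _); case: (k == _); rewrite /= ?expr1n ?expr0n ?mulr0 ?addr0.
apply/eqP/andP=> [<-|[/eqP mo /eqP ->]].
  split; last by apply/eqP/mnmP => i; rewrite mhalfE mulmnE muln2 doubleK.
  apply/eqP; rewrite /modds -[RHS](filter_pred0 (enum 'I_n)); apply: eq_filter => i.
  by rewrite mulmnE muln2 odd_double.
apply/mnmP => i; rewrite mulmnE mhalfE muln2.
have : i \notin modds m by rewrite mo.
rewrite mem_filter mem_enum andbT => /negbTE oi.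
by rewrite -[RHS]odd_double_half oi.
Qed.

Lemma mcoeff_mulXU H m (l : 'I_n) :
  ('X_l * H)@_m = if (0 < m l)%N then H@_(m - U_(l))%MM else 0.
Proof.
case: ifP => [ml|/negbT]; last rewrite -eqn0Ngt => /eqP ml.
  have le_Um : (U_(l) <= m)%MM by apply/mnm_lepP => i; rewrite mnm1E; case: eqP => [<-|].
  by rewrite mulrC -[in LHS](submK le_Um) addmC mcoeffMX.
elim/mpolyind: H => [|c k H _ _ IH]; first by rewrite mulr0 mcoeff0.
rewrite mulrDr mcoeffD IH addr0 -scalerAr -mpolyXD mcoeffZ mcoeffX.
case: eqP => [e|_]; last by rewrite mulr0.
by move: ml; rewrite -e mnmDE mnm1E eqxx.
Qed.

Lemma map_rem_val (l : 'I_n) (e : seq 'I_n) :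
  map val (rem l e) = rem (val l) (map val e).
Proof. by elim: e => //= i e IH; rewrite val_eqE; case: eqP => //= _; rewrite IH. Qed.

Lemma rem_modds m l : rem l (modds m) = [seq i <- enum 'I_n | odd (m i) && (i != l)].
Proof.
rewrite rem_filter; last by rewrite filter_uniq // enum_uniq.
by rewrite /modds; elim: (enum _) => //= i e IH; case: (odd _) => //=; rewrite IH.
Qed.

(** Induction on the linear forms: the first one contributes a variable u_l. If [m l] is odd, one
    odd exponent is used up and the halves stay the same, which is the expansion of the permanent
    along a row. *)
Lemma coef_forms (L : nat -> nat -> A) E m H :
  (size E <= size (modds m))%N ->
  ((\prod_(j <- E) \sum_(l < n) L j l *: 'X_l) * H ^+ 2)@_m =
    if size E == size (modds m) then
      perm_sum L E (map val (modds m)) * H@_(mhalf m) ^+ 2 else 0.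
Proof.
elim: E m => [|j E IH] m szE.
  by rewrite big_nil mul1r mcoeff_sqr [size [::] == _]eq_sym size_eq0 /= mul1r.
rewrite big_cons -mulrA mulr_suml raddf_sum /=.
have step (l : 'I_n) : (L j l *: 'X_l *
    ((\prod_(j <- E) \sum_(l < n) L j l *: 'X_l) * H ^+ 2))@_m =
    if odd (m l) then if (size E).+1 == size (modds m) then
      L j l * (perm_sum L E (rem (val l) (map val (modds m))) * H@_(mhalf m) ^+ 2)
    else 0 else 0.
  rewrite -scalerAl mcoeffZ mcoeff_mulXU.
  have subE i : (m - U_(l))%MM i = (m i - (l == i))%N by rewrite mnmBE mnm1E.
  case ol: (odd (m l)).
    have ml : (0 < m l)%N by case: (m l) ol.
    have oddsE : modds (m - U_(l))%MM = rem l (modds m).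
      rewrite rem_modds; apply: eq_filter => i; rewrite subE eq_sym.
      by case: eqP => [->|_] /=; rewrite ?subn0 ?andbT ?andbF // oddB ?ol.
    have lm : l \in modds m by rewrite mem_filter ol mem_enum.
    have szr : size (rem l (modds m)) = (size (modds m)).-1 by rewrite size_rem.
    have sz0 : (0 < size (modds m))%N by case: (modds m) lm.
    rewrite ml IH oddsE szr; last by rewrite -ltnS prednK.
    rewrite -(inj_eq succn_inj) prednK //.
    have -> : mhalf (m - U_(l))%MM = mhalf m.
      apply/mnmP => i; rewrite !mhalfE subE; case: eqP => [<-|_]; last by rewrite subn0.
      by rewrite -[in LHS](odd_double_half (m l)) ol add1n subn1 doubleK.
    by rewrite map_rem_val; case: eqP => _; rewrite ?mulr0.
  case: ifP => [ml|_]; last by rewrite mulr0.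
  (* If [m l] is even and positive, removing u_l creates one more odd exponent, and too few linear
     forms are left to account for them. *)
  have szo : (size (modds m) < size (modds (m - U_(l))%MM))%N.
    have -> : size (modds m) = size (rem l (modds (m - U_(l))%MM)).
      rewrite rem_modds; congr size; apply: eq_filter => i; rewrite subE eq_sym.
      by case: eqP => [->|_] /=; rewrite ?subn0 ?andbT ?andbF ?ol.
    have lm : l \in modds (m - U_(l))%MM.
      by rewrite mem_filter subE eqxx oddB // ol mem_enum.
    by rewrite size_rem // prednK //; case: (modds _) lm.
  have lt_E : (size E < size (modds (m - U_(l))%MM))%N := ltn_trans szE szo.
  by rewrite (IH _ (ltnW lt_E)) (ltn_eqF lt_E) mulr0.
rewrite (eq_bigr _ (fun l _ => step l)) -big_mkcond /=.
case: ifP => _; last by rewrite big1.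
under eq_bigr => l _ do rewrite mulrA.
rewrite -mulr_suml; congr (_ * _).
have foldE (f : nat -> A) (O : seq 'I_n) :
    foldr (fun x s => f x + s) 0 (map val O) = \sum_(l <- O) f (val l).
  by elim: O => [|l O IHO]; rewrite ?big_nil // big_cons -IHO.
rewrite (foldE (fun x => L j x * perm_sum L E (rem x (map val (modds m))))).
by rewrite [in RHS]/modds big_filter big_enum_cond.
Qed.

End FormCoefficients.

Section EvaluateForms.
Variables (F : comUnitRingType) (A : comNzRingType) (io : {rmorphism F -> A}) (n : nat).
Hypothesis A2 : 2%N \in [pchar A].
Local Notation fcoef := (form_coef +%R *%R (0 : A) 1).

Lemma odds_modds a : size a = n -> odds a = map val (modds (lmon n a)).
Proof.
move=> sza; rewrite /odds sza -val_enum_ord filter_map; congr map.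
by apply: eq_filter => i /=; rewrite mnmE.
Qed.

Lemma lmon_eq0 a : size a = n -> (lmon n a == 0%MM) = all (eq_op 0%N) a.
Proof.
move=> sza; apply/eqP/allP => [a0 x|a0].
  rewrite -{1}(lmonK sza) => /mapP[i _ ->].
  by have := congr1 (fun m : 'X_{1..n} => m i) a0; rewrite mnm0E => ->.
apply/mnmP => i; rewrite mnmE mnm0E; apply/esym/eqP/a0/mem_nth.
by rewrite sza.
Qed.

Lemma Xl_half (R : comNzRingType) a : size a = n ->
  Xl R n a = XE R (modds (lmon n a)) * Xl R n (map half a) ^+ 2.
Proof. by move=> sza; rewrite /Xl [LHS]mpolyX_half mhalf_lmon. Qed.

(** Each binary digit of [b] contributes linear forms times a square, to which [coef_forms] applies;
    the square holds the remaining digits. *)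
Lemma form_coefP (q : nat -> A) fuel b t :
  size b = n -> size t = n -> form_coef_ok fuel b t ->
  (theta io (fun l : 'I_n => q l) (Xl F n b))@_(lmon n t) =
    fcoef (fun j l => q l ^+ (2 ^ j)) fuel b t.
Proof.
elim: fuel b t => [|fuel IH] b t szb szt /= okb.
  have -> : Xl F n b = 1.
    by rewrite /Xl; move: okb; rewrite -lmon_eq0 // => /eqP ->; rewrite mpolyX0.
  rewrite rmorph1 mcoeff1 -(lmon_eq0 szt).
  by case: (lmon n t == 0%MM).
pose L (j l : nat) := q l ^+ (2 ^ j).
have thetaE : theta io (fun l : 'I_n => q l) (Xl F n b) =
    (\prod_(j <- odds b) \sum_(l < n) L j l *: 'X_l) *
    theta io (fun l : 'I_n => q l) (Xl F n (map half b)) ^+ 2.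
  rewrite (Xl_half _ szb) rmorphM rmorphXn; congr (_ * _).
  rewrite /XE rmorph_prod odds_modds // big_map; apply: eq_bigr => j _ /=.
  by rewrite thetaXU; apply: eq_bigr => l _; rewrite mxE.
have szE : (size (odds b) <= size (modds (lmon n t)))%N.
  rewrite -(size_map val) -(odds_modds szt).
  by case/orP: okb => [/ltnW //|/andP[/eqP-> _]].
rewrite thetaE coef_forms // -(odds_modds szt) -(size_map val) -(odds_modds szt).
case: eqP okb => [->|_ _ //]; rewrite ltnn /= => okb.
by rewrite mhalf_lmon // IH ?size_map // expr2.
Qed.

End EvaluateForms.

Lemma eq_permanent (T : Type) add mul (zero one : T) (L L' : nat -> nat -> T) E O :
  {in E & O, L =2 L'} ->
  permanent add mul zero one L E O = permanent add mul zero one L' E O.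
Proof.
elim: E O => [//|j E IH] O eqL /=.
pose f (M : nat -> nat -> T) l u :=
  add (mul (M j l) (permanent add mul zero one M E (rem l O))) u.
suff H O' : {subset O' <= O} -> foldr (f L) zero O' = foldr (f L') zero O' by exact: H.
elim: O' => [//|l O' IHO] sub /=.
rewrite IHO => [|x xO]; last by apply: sub; rewrite in_cons xO orbT.
have lO : l \in O by apply: sub; rewrite mem_head.
congr (add (mul _ _) _); first by apply: eqL; rewrite ?mem_head.
by apply: IH => x y xE yO; apply: eqL; [rewrite in_cons xE orbT | exact: mem_rem yO].
Qed.

(** Only entries with indices below [n] are consulted, so the formula for the matrix may be
    exchanged for lists that return a default outside this range. *)
Lemma eq_form_coef n (T : Type) add mul (zero one : T) (L L' : nat -> nat -> T) fuel b t :
  (forall j l, (j < n)%N -> (l < n)%N -> L j l = L' j l) ->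
  size b = n -> size t = n ->
  form_coef add mul zero one L fuel b t = form_coef add mul zero one L' fuel b t.
Proof.
move=> eqL; elim: fuel b t => [//|fuel IH] b t szb szt /=.
case: ifP => // _; rewrite (IH (map half b) (map half t)) ?size_map //.
congr (mul _ _); apply: eq_permanent => j l.
rewrite !mem_filter !mem_iota szb szt => /andP[_ lt_j] /andP[_ lt_l].
exact: eqL.
Qed.

(** * The functional y *)

Section TheFunctional.
Variable F : comUnitRingType.
Hypothesis F_le1 : forall c : F, c = 0 \/ c = 1.
Local Notation P := {mpoly F[5]}.

Definition y_fun (h : P) : F := \sum_(t <- y_terms) h@_(lmon 5 t).

Fact y_fun_is_additive : nmod_morphism y_fun.
Proof.
split=> [|h h']; rewrite /y_fun; first by rewrite big1 // => t _; rewrite mcoeff0.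
by rewrite -big_split; apply: eq_bigr => t _; rewrite mcoeffD.
Qed.

HB.instance Definition _ :=
  Algebra.isNmodMorphism.Build P F y_fun y_fun_is_additive.

Lemma y_terms_ok t : t \in y_terms -> size t = 5%N /\ sumn t = 50%N.
Proof.
have /allP chk : all (fun t => (size t == 5%N) && (sumn t == 50%N)) y_terms by [].
by move/chk/andP => [/eqP-> /eqP->].
Qed.

Lemma mdeg_lmon n a : size a = n -> mdeg (lmon n a) = sumn a.
Proof. by move=> sza; rewrite -[in RHS](lmonK sza) sumnE big_map big_enum mdegE. Qed.

Lemma y_concentrated : concentrated 50 y_fun.
Proof.
move=> m dm; rewrite /y_fun big_seq big1 // => t /y_terms_ok[szt sumt].
rewrite mcoeffX; case: (m =P lmon 5 t) dm => [->|_ _]; last exact: mulr0n.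
by rewrite mdeg_lmon // sumt eqxx.
Qed.

Lemma y_funX v : size v = 5%N -> y_fun (Xl F 5 v) = (v \in y_terms)%:R.
Proof.
move=> szv; rewrite /y_fun.
have -> : (v \in y_terms)%:R = \sum_(t <- y_terms) (t == v)%:R :> F.
  have : uniq y_terms by [].
  elim: y_terms => [|t l IH] /=; first by rewrite big_nil.
  case/andP => tl /IH; rewrite big_cons in_cons eq_sym => <-.
  by case: eqP tl => [<- /negbTE ->|_ _]; rewrite ?addr0 ?add0r.
rewrite big_seq [RHS]big_seq; apply: eq_bigr => t /y_terms_ok[szt _].
rewrite mcoeffX eq_sym; congr (nat_of_bool _)%:R; apply/eqP/eqP => [e|-> //].
by rewrite -(lmonK szt) -(lmonK szv) e.
Qed.

(** The terms of Sq^k u^a have exponents a_j + i_j with the i_j taken from [odd_bins] and of sum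
    [k]. *)
Lemma preimages_sq_list k a v : size a = 5%N -> v \in sq_list id k a ->
  a \in preimages v /\ sumn v = (sumn a + k)%N.
Proof.
case: a => [|a0 [|a1 [|a2 [|a3 [|a4 [|]]]]]] // _; rewrite /sq_list /=.
have bins x i : i \in odd_bins x x -> (i <= x)%N by apply: (odd_binsP (leqnn x)).1.
case/flatten_mapP=> i0; rewrite mem_filter => /andP[k0 b0] /mapP[v0 + ->].
case/flatten_mapP=> i1; rewrite mem_filter => /andP[k1 b1] /mapP[v1 + ->].
case/flatten_mapP=> i2; rewrite mem_filter => /andP[k2 b2] /mapP[v2 + ->].
case/flatten_mapP=> i3; rewrite mem_filter => /andP[k3 b3] /mapP[v3 + ->].
case/flatten_mapP=> i4; rewrite mem_filter => /andP[k4 b4] /mapP[v4 + ->].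
case: ifP => // /eqP kE; rewrite inE => /eqP -> /=.
have [l0 l1 l2 l3 l4] := And5 (bins _ _ b0) (bins _ _ b1) (bins _ _ b2) (bins _ _ b3) (bins _ _ b4).
rewrite /vadd /= !addn0 !add0n.
have e x i : (i <= x)%N -> (x - i + i.*2 = x + i)%N by lia.
rewrite !e //; split; last by lia.
have pre x i : i \in odd_bins x x -> x \in preimages1 (x + i).
  by move=> bi; rewrite mem_filter addKn bi mem_iota /= add0n ltnS leq_addr.
do 4!(apply/allpairsPdep; eexists; eexists; split; [exact: pre| |reflexivity]).
by apply/flatten_mapP; exists a4; [exact: pre | rewrite inE].
Qed.

Lemma y_check_ok : y_check. Proof. by vm_compute. Qed.

(** If Sq^k u^a meets [y_terms] at all, then [a] is among the finitely many preimages that [y_check]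
    inspects, and the number of common terms, with multiplicity, is even. *)
Lemma y_kills_hits : kills_hits 1%g y_fun.
Proof.
move=> k h k0; have F2 : 2%N \in [pchar F].
  rewrite inE /=; case: (F_le1 2%:R) => [->|/eqP]; first exact: eqxx.
  by rewrite -subr_eq0 (natrD _ 1 1) addrK oner_eq0.
elim/(@mpoly_ind01 F 5 F_le1): h => [|h h' IH IH'|m].
- by rewrite rmorph0 coef0 raddf0.
- have -> := coef_tsqD 1%g k h h'.
  exact (etrans (raddfD y_fun _ _) (etrans (congr2 +%R IH IH') (addr0 0))).
pose a := [seq m i | i <- enum 'I_5].
have sza : size a = 5%N by rewrite size_map size_enum_ord.
have -> : 'X_[m] = Xl F 5 a.
  congr 'X_[_]; apply/mnmP => i.
  by rewrite mnmE (nth_map i) ?size_enum_ord // nth_ord_enum.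
rewrite (@sq_listP F 5 1%g id _ F2 k a sza) => [|j]; last by rewrite perm1.
rewrite raddf_sum big_seq.
rewrite (eq_bigr (fun v => (v \in y_terms)%:R)) => [|v vin]; last first.
  by apply: y_funX; rewrite -sza; exact: size_sq_terms vin.
rewrite -big_seq -natr_sum -big_mkcond sum1_count.
have [/hasP[v vin vy]|no] := boolP (has (mem y_terms) (sq_list id k a)); last first.
  by move: no; rewrite has_count lt0n negbK => /eqP ->.
have [apre sumv] := preimages_sq_list sza vin.
have [_ sum50] := y_terms_ok vy.
have /allP/(_ v vy)/allP/(_ a apre) := y_check_ok.
have -> : (50 - sumn a = k)%N by lia.
rewrite (gtn_eqF k0) orFb => /negbTE ev; rewrite -(odd_double_half (count _ _)) ev add0n.
by rewrite -muln2 natrM (pcharf0 F2) mulr0.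
Qed.

Section Extended.
Variables (A : comNzRingType) (io : {rmorphism F -> A}).

Lemma xhat_y H : xhat io y_fun H = \sum_(t <- y_terms) H@_(lmon 5 t).
Proof.
elim/mpolyind: H => [|c m H _ _ IH].
  by rewrite raddf0 big1 // => t _; rewrite mcoeff0.
have eZ : xhat io y_fun (c *: 'X_[m]) = c * io (y_fun 'X_[m]).
  by rewrite linearZ; exact (congr1 ( *%R c) (xhatX io y_fun m)).
have -> : xhat io y_fun (c *: 'X_[m] + H) =
    c * io (y_fun 'X_[m]) + \sum_(t <- y_terms) H@_(lmon 5 t).
  exact (etrans (raddfD (xhat io y_fun) _ _) (congr2 +%R eZ IH)).
rewrite [RHS](eq_bigr (fun t => (c *: 'X_[m])@_(lmon 5 t) + H@_(lmon 5 t))) => [|t _]; last first.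
  by rewrite mcoeffD.
rewrite [RHS]big_split /=; congr (_ + _); rewrite rmorph_sum mulr_sumr; apply: eq_bigr => t _.
by rewrite mcoeffZ !mcoeffX (rmorph_nat io).
Qed.

End Extended.

End TheFunctional.

Definition z32 : F32 := zpow 1.

Lemma mulzE x : F32.mulz x = z32 * x.
Proof.
by apply: F32Ring.eqfP; move: x; apply: F32Ring.all32P; vm_compute.
Qed.

Lemma zpowE i : zpow i = z32 ^+ i.
Proof. by elim: i => [//|i IH]; rewrite exprS -IH -mulzE. Qed.

Lemma pow2E j x : pow2 j x = x ^+ (2 ^ j).
Proof.
elim: j => [|j IH]; first by rewrite expr1.
by rewrite expnSr exprM -IH expr2.
Qed.

Lemma foldr_add32 (I : Type) (r : seq I) (f : I -> F32) :
  foldr (fun i s => F32.add (f i) s) F32.zero r = \sum_(i <- r) f i.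
Proof. by elim: r => [|i r /= ->]; rewrite ?big_nil ?big_cons. Qed.

Lemma trace32E x : trace32 x = \sum_(j < 5) x ^+ (2 ^ j).
Proof.
rewrite /trace32 foldr_add32 -(big_mkord xpredT (fun j => x ^+ (2 ^ j))).
by apply: eq_bigr => j _; rewrite pow2E.
Qed.

Lemma frob32 (x : F32) : x ^+ (2 ^ 5) = x.
Proof.
rewrite -pow2E; apply: F32Ring.eqfP; move: x; apply: F32Ring.all32P.
by vm_compute.
Qed.

Lemma z32_order : z32 ^+ (2 ^ 5 - 1) = 1.
Proof. by rewrite -zpowE; apply: F32Ring.eqfP; vm_compute. Qed.

Lemma z32_sum w : ~~ (2 ^ 5 - 1 %| w)%N -> \sum_(k < 2 ^ 5 - 1) z32 ^+ (k * w) = 0.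
Proof.
move=> Nw; have chk : all (fun r =>
    foldr (fun k s => F32.add (zpow (k * r)) s) F32.zero (iota 0 31) == F32.zero)
    (iota 1 30) by vm_compute.
have /allP/(_ (w %% 31)%N) := chk; rewrite mem_iota ltn_mod lt0n andbT => /(_ Nw)/eqP.
rewrite foldr_add32 => e; rewrite -[RHS]e -(big_mkord xpredT (fun k => z32 ^+ (k * w))).
apply: eq_bigr => k _; rewrite zpowE {1}(divn_eq w 31) mulnDr exprD mulnA mulnC.
by rewrite exprM z32_order expr1n mul1r.
Qed.

Lemma dual_checkP u : dual_check u ->
  dual_bases (fun l : 'I_5 => nth 0 (permuted basis32 u) l)
             (fun l : 'I_5 => nth 0 (permuted dual32 u) l).
Proof.
move=> /allP chk l l'.
have /chk/allP/(_ (val l')) : val l \in iota 0 5 by rewrite mem_iota ltn_ord.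
rewrite mem_iota ltn_ord => /(_ isT)/eqP; rewrite trace32E => e.
rewrite [LHS]e -val_eqE; by case: (val l == val l').
Qed.

Section PrimeField.
Variable F : comUnitRingType.
Hypothesis F_le1 : forall c : F, c = 0 \/ c = 1.

(** The hypothesis is an argument because the morphism instances below depend on it. *)
Definition embed32 of (forall c : F, c = 0 \/ c = 1) := fun c : F =>
  if c == 0 then 0 else 1 : F32.
Local Notation io := (embed32 F_le1).

Lemma F_le1_addrr : 1 + 1 = 0 :> F.
Proof.
by case: (F_le1 (1 + 1)) => // /eqP; rewrite -subr_eq0 addrK oner_eq0.
Qed.

Fact embed32_is_additive : nmod_morphism io.
Proof.
split=> [|c c']; first by rewrite /embed32 eqxx.
case: (F_le1 c) (F_le1 c') => -> [] ->;
  by rewrite /embed32 ?addr0 ?add0r ?F_le1_addrr ?eqxx ?oner_eq0 ?addr0 ?add0r.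
Qed.

Fact embed32_is_multiplicative : monoid_morphism io.
Proof.
split=> [|c c']; first by rewrite /embed32 oner_eq0.
case: (F_le1 c) (F_le1 c') => -> [] ->;
  by rewrite /embed32 ?mulr0 ?mul0r ?mulr1 ?eqxx ?oner_eq0 ?mulr0 ?mul0r ?mulr1.
Qed.

HB.instance Definition _ :=
  Algebra.isNmodMorphism.Build F F32 io embed32_is_additive.
HB.instance Definition _ :=
  GRing.isMonoidMorphism.Build F F32 io embed32_is_multiplicative.

Lemma basis32_span (a : F32) :
  exists c : 'I_5 -> F, a = \sum_(i < 5) nth 0 (permuted basis32 [:: 0; 1; 2; 3; 4]%N) i * io (c i).
Proof.
case: a => a b c d e; exists (fun i => (nth false [:: a; b; c; d; e] i)%:R).
have ioE (x : bool) : io x%:R = delta32 x.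
  by case: x; rewrite ?rmorph1 ?rmorph0.
rewrite !big_ord_recl big_ord0 /= !ioE.
by case: a b c d e => [] [] [] [] []; apply: F32Ring.eqfP; vm_compute.
Qed.

End PrimeField.

(** * Degree 50 *)

(** The coefficients [e] are chosen before [L], so the same 20 unknowns serve all admissible
    functionals. *)
Lemma orbit_span_sum (F A : comNzRingType) (s : seq 'X_{1..5}) (c : 'X_{1..5} -> A) :
  (forall x : F, x = 0 \/ x = 1) -> 2%N \in [pchar A] ->
  exists e : nat -> A, forall L : {additive {mpoly F[5]} -> A}, admissible 50 L ->
    \sum_(m <- s) c m * L 'X_[m] =
    \sum_(j < size free_orbits) e j * L (Xl F 5 (nth [::] free_orbits j)).
Proof.
move=> F_le1 A2; elim: s => [|m s [e IH]].
  by exists (fun=> 0) => L _; rewrite big_nil big1 // => j _; rewrite mul0r.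
have sza : size [seq m i | i <- enum 'I_5] = 5%N by rewrite size_map size_enum_ord.
have [r rE] := orbit_span F_le1 A2 sza.
exists (fun j => c m * (nth false r j)%:R + e j) => L La.
rewrite big_cons (IH L La).
have -> : 'X_[m] = Xl F 5 [seq m i | i <- enum 'I_5].
  congr 'X_[_]; apply/mnmP => i.
  by rewrite mnmE (nth_map i) ?size_enum_ord // nth_ord_enum.
rewrite (rE L La) mulr_sumr -big_split; apply: eq_bigr => j _.
rewrite mulrDl; congr (_ + _); rewrite -mulrA.
by case: (nth false r j); rewrite ?mul1r ?mul0r.
Qed.

Lemma free_orbits_ok : all (fun b =>
  [&& size b == 5, 31 %| weight b & all (form_coef_ok 5 b) y_terms])%N free_orbits.
Proof. by vm_compute. Qed.

Lemma perms_ok : all (fun u => (size u == 5%N) && dual_check u) perms.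
Proof. by vm_compute. Qed.

Lemma combos_ok : combos_check y_matrix.
Proof. by vm_compute. Qed.

Lemma combos_checkP W i : combos_check W -> (i < 20)%N ->
  exists S, [/\ ~~ odd (size S), {in S, forall k, (k < 21)%N} &
    forall j, (j < 20)%N -> \sum_(k <- S) nth 0 (nth [::] W k) j = (i == j)%:R].
Proof.
move=> /allP chk lt_i; have := chk i.
rewrite mem_iota => /(_ lt_i)/andP[/andP[ev /allP bd] /allP e].
exists (nth [::] combos i); split=> // j lt_j.
have := e j; rewrite mem_iota => /(_ lt_j)/eqP; rewrite foldr_add32 => e1.
by rewrite [LHS]e1; case: (i == j).
Qed.

Lemma y_matrixE k j : (k < size perms)%N -> (j < size free_orbits)%N ->
  nth 0 (nth [::] y_matrix k) j = y_value (nth [::] perms k) (nth [::] free_orbits j).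
Proof. by move=> lt_k lt_j; rewrite (nth_map [::]) // (nth_map [::]). Qed.

Section DegreeFifty.
Variable F : comUnitRingType.
Hypothesis F_le1 : forall c : F, c = 0 \/ c = 1.
Local Notation io := (embed32 F_le1).
Local Notation base u := (fun l : 'I_5 => nth 0 (permuted basis32 u) l).

Let A2 : 2%N \in [pchar F32] := pchar_A2 io F_le1.

Lemma average_yE u b : size u = 5%N -> b \in free_orbits ->
  average io z32 (@y_fun F) (base u) (Xl F 5 b) = y_value u b.
Proof.
move=> szu /(allP free_orbits_ok)/and3P[/eqP szb wb /allP ok_b].
have wb' : (2 ^ 5 - 1 %| wt (lmon 5 b))%N by rewrite -weightE.
have := average_trace io F_le1 (isT : odd 5) z32_order z32_sum (@y_fun F) (base u) wb'.
move=> e; rewrite [LHS]e /y_value trace32E; apply: eq_bigr => i _; congr (_ ^+ _).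
rewrite /lam foldr_add32 [LHS]xhat_y big_seq [RHS]big_seq; apply: eq_bigr => t ty.
have [szt _] := y_terms_ok ty.
have := form_coefP io A2 (nth 0 (permuted basis32 u)) szb szt (ok_b t ty).
move=> e1; rewrite [LHS]e1; apply: (@eq_form_coef 5) => // j l lt_j lt_l.
rewrite (nth_map 0%N) ?size_iota // nth_iota // [RHS](nth_map 0) ?size_map ?szu //.
by rewrite pow2E.
Qed.

Lemma average_admissible (X : {additive {mpoly F[5]} -> F}) q :
  kills_hits 1%g X -> concentrated 50 X -> admissible 50 (average io z32 X q).
Proof.
move=> Xh Xd; split.
- exact (average_kills_hits io F_le1 frob32 z32 q Xh).
- exact (average_concentrated io z32 q Xd).
- move=> m Nm.
  apply: etrans (averageX io F_le1 (isT : odd 5) z32_order z32_sum X q m) _.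
  by rewrite (negbTE Nm).
- move=> m; exact (average_mrot io F_le1 frob32 (isT : odd 5) z32_order z32_sum X q m).
Qed.

Lemma no_invariant_class50 : no_invariant_class F 5 50.
Proof.
move=> f f_inv X Xh Xd.
have dual u : u \in perms -> dual_bases (base u) (fun l : 'I_5 => nth 0 (permuted dual32 u) l).
  by move=> /(allP perms_ok)/andP[_]; exact: dual_checkP.
have u0 : [:: 0; 1; 2; 3; 4]%N \in perms by rewrite mem_head.
have [H HE] := invariant_expansion F_le1 (isT : odd 5) z32_order (dual _ u0)
  (basis32_span F_le1) f_inv.
have [e eE] := orbit_span_sum (msupp H) (fun m => H@_m) F_le1 A2.
have expand (Y : {additive {mpoly F[5]} -> F}) u : kills_hits 1%g Y -> concentrated 50 Y ->
    u \in perms -> io (Y f) = \sum_(j < size free_orbits)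
      e j * average io z32 Y (base u) (Xl F 5 (nth [::] free_orbits j)).
  move=> Yh Yd uin; rewrite (HE Y _ _ Yh Yd (dual u uin)).
  exact (eE _ (average_admissible (base u) Yh Yd)).
have e0 j : (j < 20)%N -> e j = 0.
  move=> lt_j; have [S [evS bdS SE]] := combos_checkP combos_ok lt_j.
  (* Every permuted basis expands the same number, the value of y at [f]. *)
  have row k : (k < 21)%N -> \sum_(i < 20) e i * nth 0 (nth [::] y_matrix k) i = io (y_fun f).
    move=> lt_k; have uin : nth [::] perms k \in perms by exact: mem_nth.
    have /eqP szu := proj1 (andP (allP perms_ok _ uin)).
    rewrite (expand _ _ (y_kills_hits F_le1) (@y_concentrated F) uin).
    apply: eq_bigr => i _; congr (_ * _); rewrite (y_matrixE lt_k (ltn_ord i)).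
    by rewrite average_yE // mem_nth.
  (* [S] has even size, so the equal row values cancel; exchanging the sums leaves the unit vector,
     that is, [e j]. *)
  have : \sum_(k <- S) \sum_(i < 20) e i * nth 0 (nth [::] y_matrix k) i = 0.
    rewrite big_seq (eq_bigr (fun=> io (y_fun f))) => [|k /bdS]; last exact: row.
    rewrite -big_seq big_const_seq count_predT iter_addr_0 -(odd_double_half (size S)).
    by rewrite (negbTE evS) add0n -mul2n mulrnA mulr2n (addrr_char2 A2) mul0rn.
  rewrite exchange_big /= (bigD1 (Ordinal lt_j)) //= -mulr_sumr SE // eqxx mulr1.
  rewrite big1 ?addr0 // => i ne_ij; rewrite -mulr_sumr SE ?ltn_ord //.
  by rewrite eq_sym -val_eqE /= in ne_ij *; rewrite (negbTE ne_ij) mulr0.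
have ioX : io (X f) = 0.
  rewrite (expand X _ Xh Xd u0) big1 // => j _.
  by rewrite e0 ?mul0r // ltn_ord.
by case: (F_le1 (X f)) ioX => -> // /eqP; rewrite rmorph1 oner_eq0.
Qed.

End DegreeFifty.

(** * The degrees d_t *)

(** 54 and 53 have four binary digits 1. The next two numbers are 2M + 1 and 2M with
    [M = 55 * 2 ^ t - 1], so doubling preserves the bound. *)
Lemma pow2_sum_55 t :
  (forall ks, \sum_(j <- ks) 2 ^ j = 55 * 2 ^ t - 1 -> 4 <= size ks)%N /\
  (forall ks, \sum_(j <- ks) 2 ^ j = 55 * 2 ^ t - 2 -> 4 <= size ks)%N.
Proof.
elim: t => [|t [IH _]].
  by split=> ks e; have := popcount_le 6 ks; rewrite e.
have [even_ok odd_ok] := pow2_sum_double IH.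
have := expn_gt0 2 t; move: even_ok odd_ok; rewrite expnS.
move: (2 ^ t)%N => k even_ok odd_ok k0; split=> ks e.
  by apply/ltnW/odd_ok; rewrite e; lia.
by apply: even_ok; rewrite e; lia.
Qed.

Lemma no_invariant_class_family (F : comUnitRingType) (F_le1 : forall c : F, c = 0 \/ c = 1) t :
  no_invariant_class F 5 (5 * (2 ^ t - 1) + 50 * 2 ^ t)%N.
Proof.
elim: t => [|t IH]; first exact: no_invariant_class50.
have -> : (5 * (2 ^ t.+1 - 1) + 50 * 2 ^ t.+1 =
           (5 * (2 ^ t - 1) + 50 * 2 ^ t).*2 + 5)%N.
  by have := expn_gt0 2 t; rewrite expnS; move: (2 ^ t)%N => k; lia.
apply: kameko_step IH => // ks lt5; apply/eqP => e.
have [sum1 sum2] := pow2_sum_55 t.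
(* Here d_t = 55 * 2^t - 5, so 2 d_t + 5 is odd and the number of summands must be odd. Sizes 1 and
   3 lead to the sums [55 * 2 ^ t - 2] and [55 * 2 ^ t - 1], which need at least four powers of
   2. *)
have S4 : (size ks = 1 \/ size ks = 3)%N by lia.
have := expn_gt0 2 t; move: sum1 sum2 e; move: (2 ^ t)%N => k sum1 sum2 e k0.
case: S4 => szks.
  by have := sum2 ks; rewrite szks => H; have := H ltac:(lia).
by have := sum1 ks; rewrite szks => H; have := H ltac:(lia).
Qed.

Theorem theorem2p3 (t : nat)
    (x : GL_coinvariants (PA_act 5 (5 * (2 ^ t - 1) + 50 * 2 ^ t)%N)) :
  x = 0.
Proof. exact (coinvariants_eq0 (@no_invariant_class_family _ F2_le1 t) x). Qed.
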